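(* Let $\Omega$ be a bounded domain in $\mathbb{R}^n$, let $s\in(0,1)$, and let $p:\mathbb{R}^n\times\mathbb{R}^n\to\mathbb{R}$ be continuous with $p(x,y)=p(y,x)$ for all $x,y$ and $1<\inf_{x,y\in\mathbb{R}^n}p(x,y)\le\sup_{x,y\in\mathbb{R}^n}p(x,y)<+\infty$. (a) If $u\in W^{s,p(\cdot,\cdot)}(\mathbb{R}^n)$ satisfies $$\sup_{x\in\Omega}\int_{\mathbb{R}^n}\frac{u_+(y)^{p(x,y)-1}}{1+|y|^{n+sp(x,y)}}\,\mathrm{d}y<+\infty$$ and $u$ is a weak subsolution to $(-\Delta)^s_{p(\cdot,\cdot)}u=0$ in $\Omega$, then $u$ is locally bounded from above in $\Omega$. (b) If $u\in W^{s,p(\cdot,\cdot)}(\mathbb{R}^n)$ satisfies $$\sup_{x\in\Omega}\int_{\mathbb{R}^n}\frac{u_-(y)^{p(x,y)-1}}{1+|y|^{n+sp(x,y)}}\,\mathrm{d}y<+\infty$$ and $u$ is a weak supersolution to $(-\Delta)^s_{p(\cdot,\cdot)}u=0$ in $\Omega$, then $u$ is locally bounded from below in $\Omega$. (c) If $u\in W^{s,p(\cdot,\cdot)}(\mathbb{R}^n)$ is a weak solution to $(-\Delta)^s_{p(\cdot,\cdot)}u=0$ in $\Omega$ satisfying $$\sup_{x\in\Omega}\int_{\mathbb{R}^n}\frac{|u(y)|^{p(x,y)-1}}{1+|y|^{n+sp(x,y)}}\,\mathrm{d}y<+\infty,$$ then $u\in L^\infty_{\mathrm{loc}}(\Ome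ga)$.
   Context: Here $n\in\mathbb{N}$, $u_\pm=\max\{\pm u,0\}$, and bounds on functions are understood in the almost everywhere (essential) sense. Function space. With $\bar p(x)=p(x,x)$, $W^{s,p(\cdot,\cdot)}(\mathbb{R}^n)$ is the set of measurable $u:\mathbb{R}^n\to\mathbb{R}$ such that for some $\lambda>0$ both $\int_{\mathbb{R}^n}|u(x)/\lambda|^{\bar p(x)}\,\mathrm{d}x<+\infty$ and $\varrho(u/\lambda)<+\infty$, where $$\varrho(u)=\int_{\mathbb{R}^n}\int_{\mathbb{R}^n}\frac{|u(x)-u(y)|^{p(x,y)}}{|x-y|^{n+sp(x,y)}}\,\mathrm{d}y\,\mathrm{d}x.$$ Weak (sub/super)solutions. A function $u\in W^{s,p(\cdot,\cdot)}(\mathbb{R}^n)$ is a weak subsolution (weak supersolution) to $(-\Delta)^s_{p(\cdot,\cdot)}u=0$ in $\Omega$ if $$\int_{\mathbb{R}^n}\int_{\mathbb{R}^n}\frac{|u(x)-u(y)|^{p(x,y)-2}(u(x)-u(y))(\varphi(x)-\varphi(y))}{|x-y|^{n+sp(x,y)}}\,\mathrm{d}y\,\mathrm{d}x\le 0\quad(\ge 0)$$ for every nonnegative $\varphi\in W^{s,p(\cdot,\cdot)}(\mathbb{R}^n)$ with $\varphi=0$ a.e. outside $\Omega$ (the expression $|t|^{p-2}t$ is $0$ when $t=0$). It is a weak solution if it is both a weak subsolution and a weak supersolution. *)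

(* Defs.v *)
From HB Require Import structures.
From mathcomp Require Import all_boot all_order all_algebra.
From mathcomp Require Import all_classical all_reals all_analysis.
From mathcomp Require Import measurable_realfun.

Set Implicit Arguments.
Unset Strict Implicit.
Unset Printing Implicit Defensive.

Import Order.TTheory GRing.Theory Num.Theory.
Import numFieldNormedType.Exports.

Local Open Scope classical_set_scope.
Local Open Scope ring_scope.

(* Points of R^n are row vectors.  Their library topology is the usual one, but
   the library norm [`|x|] is the sup norm, hence a separate Euclidean norm. *)
Definition enorm (R : realType) (n : nat) (x : 'rV[R]_n) : R :=
  Num.sqrt (\sum_(i < n) x 0 i ^+ 2).

Definition rV_display : measure_display.
Proof. exact: default_measure_display. Qed.

(* The Borel sigma-algebra of R^n, generated by the coordinates (as the library
   does for tuples). *)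
Section measurable_rV.
Context (R : realType) (n : nat).

Let coor : 'I_n -> 'rV[R]_n -> R := fun i x => x 0 i.

Let rV_set0 : g_sigma_preimage coor set0.
Proof. exact: sigma_algebra0. Qed.

Let rV_setC A : g_sigma_preimage coor A -> g_sigma_preimage coor (~` A).
Proof. exact: sigma_algebraC. Qed.

Let rV_bigcup (F : (set 'rV[R]_n)^nat) :
  (forall i, g_sigma_preimage coor (F i)) ->
  g_sigma_preimage coor (\bigcup_i F i).
Proof. exact: sigma_algebra_bigcup. Qed.

HB.instance Definition _ := @isMeasurable.Build rV_display 'rV[R]_n
  (g_sigma_preimage coor) rV_set0 rV_setC rV_bigcup.

Lemma measurable_coor (i : 'I_n) :
  measurable_fun [set: 'rV[R]_n] (fun x : 'rV[R]_n => x 0 i).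
Proof.
move=> _ Y mY; rewrite setTI; apply: sub_sigma_algebra => /=.
rewrite -bigcup_seq/=; exists i => /=; first by rewrite mem_index_enum.
by exists Y => //; rewrite setTI.
Qed.

Lemma measurable_fun_rV d (T : measurableType d) (f : T -> 'rV[R]_n) :
  (forall i, measurable_fun [set: T] (fun t => f t 0 i)) ->
  measurable_fun [set: T] f.
Proof.
move=> mf _ Y; rewrite setTI => mY.
have : g_sigma_preimage (fun i => coor i \o f) (f @^-1` Y).
  by rewrite g_sigma_preimage_comp; exists Y => //; rewrite setTI.
apply: smallest_sub; first exact: sigma_algebra_measurable.
rewrite -bigcup_seq; apply: bigcup_sub => i _ A [B mB <-].
exact: mf.
Qed.

End measurable_rV.

Section lebesgue_measure_rV.
Context (R : realType).

Definition rV_cons (n : nat) (z : measurableTypeR R * 'rV[R]_n) : 'rV[R]_n.+1 :=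
  row_mx (const_mx z.1 : 'rV_1) z.2.

Definition rV_uncons (n : nat) (x : 'rV[R]_n.+1) : measurableTypeR R * 'rV[R]_n :=
  (x 0 ord0, \row_j x 0 (lift ord0 j)).

Lemma rV_consK n : cancel (@rV_cons n) (@rV_uncons n).
Proof.
move=> [a v]; rewrite /rV_uncons /rV_cons /=; congr pair.
  rewrite (_ : ord0 = lshift n (ord0 : 'I_1)); last exact: val_inj.
  by rewrite (@row_mxEl _ 1 1 n) mxE.
apply/rowP => j; rewrite mxE (_ : lift ord0 j = rshift 1 j); last exact: val_inj.
by rewrite (@row_mxEr _ 1 1 n).
Qed.

Lemma measurable_rV_cons n : measurable_fun setT (@rV_cons n).
Proof.
apply: measurable_fun_rV => i.
have [k ->|k ->] := @split_ordP 1 n i.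
  rewrite (_ : (fun _ => _) = fst) //.
  by apply/funext => z; rewrite (@row_mxEl _ 1 1 n) mxE.
rewrite (_ : (fun _ => _) = (fun x : 'rV[R]_n => x 0 k) \o snd); last first.
  by apply/funext => z; rewrite /rV_cons (@row_mxEr _ 1 1 n).
apply: measurableT_comp => //; exact: measurable_coor.
Qed.

Lemma measurable_rV_uncons n : measurable_fun setT (@rV_uncons n).
Proof.
apply: measurable_fun_pair; first exact: measurable_coor.
apply: measurable_fun_rV => i.
under eq_fun do rewrite mxE.
exact: measurable_coor.
Qed.

(* The product of the Lebesgue measure on R with [m], carried to R^(n+1). *)
Section step.
Context (n : nat) (m : {sigma_finite_measure set 'rV[R]_n -> \bar R}).

Definition lebesgue_step : set 'rV[R]_n.+1 -> \bar R :=
  pushforward (@lebesgue_measure R \x m)%E (@rV_cons n).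

Let lebesgue_step0 : (lebesgue_step set0 = 0)%E.
Proof. by rewrite /lebesgue_step /pushforward preimage_set0 measure0. Qed.

Let mpre (A : set 'rV[R]_n.+1) : measurable A -> measurable (@rV_cons n @^-1` A).
Proof.
by move=> mA; rewrite -[X in measurable X]setTI; exact: measurable_rV_cons.
Qed.

Let lebesgue_step_ge0 A : (0 <= lebesgue_step A)%E.
Proof. by rewrite /lebesgue_step /pushforward; apply: measure_ge0. Qed.

Let lebesgue_step_sigma_additive : semi_sigma_additive lebesgue_step.
Proof.
move=> F mF tF mUF; rewrite /lebesgue_step /pushforward preimage_bigcup.
apply: measure_semi_sigma_additive.
- by move=> k; exact: mpre.
- apply/trivIsetP => /= i j _ _ ij; rewrite -preimage_setI.
  by move/trivIsetP : tF => /(_ _ _ _ _ ij) ->//; rewrite preimage_set0.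
- by rewrite -preimage_bigcup; exact: mpre.
Qed.

HB.instance Definition _ := isMeasure.Build _ _ _ lebesgue_step
  lebesgue_step0 lebesgue_step_ge0 lebesgue_step_sigma_additive.

Let lebesgue_step_sigma_finite : sigma_finite setT lebesgue_step.
Proof.
have /sigma_finiteP[F [FT ndF Foo]] := sigma_finiteT (@lebesgue_measure R).
have /sigma_finiteP[G [GT ndG Goo]] := sigma_finiteT m.
exists (fun k => @rV_uncons n @^-1` (F k `*` G k)).
  apply/esym; rewrite -subTset => x _.
  have [i _ Fi] : (\bigcup_k F k) (rV_uncons x).1 by rewrite -FT.
  have [j _ Gj] : (\bigcup_k G k) (rV_uncons x).2 by rewrite -GT.
  exists (maxn i j) => //; split.
    by move: Fi; exact/subsetPset/ndF/leq_maxl.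
  by move: Gj; exact/subsetPset/ndG/leq_maxr.
move=> k; have [mFk Fkoo] := Foo k; have [mGk Gkoo] := Goo k; split.
  rewrite -[X in measurable X]setTI; apply: measurable_rV_uncons => //.
  exact: measurableX.
rewrite /lebesgue_step /pushforward -comp_preimage.
rewrite (_ : _ \o _ = id); last by apply/funext => z; exact: rV_consK.
by rewrite preimage_id product_measure1E// lte_mul_pinfty// ge0_fin_numE.
Qed.

HB.instance Definition _ := Measure_isSigmaFinite.Build _ _ _ lebesgue_step
  lebesgue_step_sigma_finite.

End step.

Fixpoint lebesgue_rV (n : nat) :
    {sigma_finite_measure set 'rV[R]_n -> \bar R} :=
  match n with
  | 0%N => dirac (0 : 'rV[R]_0)
  | n'.+1 => lebesgue_step (lebesgue_rV n')
  end.

End lebesgue_measure_rV.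
Arguments lebesgue_rV {R} n.

Section variable_exponent.
Context (R : realType) (n : nat).
Local Notation Rn := 'rV[R]_n.
Local Notation mu := (@lebesgue_rV R n).
Implicit Types (s : R) (p : Rn -> Rn -> R) (u phi v : Rn -> R) (Omega : set Rn).

(* Lebesgue measurability: preimages of Borel sets are Borel up to a null set.
   The library integral of a nonnegative function is a supremum over simple
   functions below it, so on this larger class it still computes the integral
   with respect to the completed measure. *)
Definition lebesgue_measurable_fun (D : set Rn) u :=
  forall B : set R, measurable B -> completed_algebra_gen mu (D `&` u @^-1` B).

Definition domain Omega := [/\ open Omega, connected Omega & Omega !=set0].

(* At x = y the denominator below is 0 and the quotient is 0 in Rocq; the
   diagonal is a null set. *)
Definition kernel_denom s p (x y : Rn) : R :=
  enorm (x - y) `^ (n%:R + s * p x y).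

Definition modular s p u : \bar R :=
  (\int[mu]_x \int[mu]_y
     (`|u x - u y| `^ (p x y) / kernel_denom s p x y)%:E)%E.

Definition Wsp s p u :=
  lebesgue_measurable_fun setT u /\
  exists2 lambda : R, 0 < lambda &
    (\int[mu]_x (`|u x / lambda| `^ (p x x))%:E < +oo)%E /\
    (modular s p (fun x => u x / lambda)%R < +oo)%E.

Definition weak_form s p u phi : \bar R :=
  (\int[mu]_x \int[mu]_y
     (`|u x - u y| `^ (p x y - 2) * (u x - u y) * (phi x - phi y)
        / kernel_denom s p x y)%:E)%E.

Definition test_fun s p Omega phi :=
  [/\ Wsp s p phi, {ae mu, forall x, 0 <= phi x}
    & {ae mu, forall x, ~ Omega x -> phi x = 0}].

Definition weak_subsolution s p Omega u :=
  Wsp s p u /\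
  forall phi, test_fun s p Omega phi -> (weak_form s p u phi <= 0)%E.

Definition weak_supersolution s p Omega u :=
  Wsp s p u /\
  forall phi, test_fun s p Omega phi -> (0 <= weak_form s p u phi)%E.

Definition weak_solution s p Omega u :=
  weak_subsolution s p Omega u /\ weak_supersolution s p Omega u.

Definition tail s p v (x : Rn) : \bar R :=
  (\int[mu]_y
     (v y `^ (p x y - 1) / (1 + enorm y `^ (n%:R + s * p x y)))%:E)%E.

Definition locally_bounded_above Omega u :=
  forall K : set Rn, compact K -> K `<=` Omega ->
    exists M : R, {ae mu, forall x, K x -> u x <= M}.

Definition locally_bounded_below Omega u :=
  forall K : set Rn, compact K -> K `<=` Omega ->
    exists M : R, {ae mu, forall x, K x -> M <= u x}.

Definition Linfty_loc Omega u :=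
  lebesgue_measurable_fun Omega u /\
  forall K : set Rn, compact K -> K `<=` Omega ->
    (Lnorm mu +oo (EFin \o (u \_ K)) < +oo)%E.

End variable_exponent.

(* Main.v *)
Require Import Defs.
From mathcomp Require Import all_boot all_order all_algebra.
From mathcomp Require Import all_classical all_reals all_analysis.
From mathcomp Require Import measurable_realfun ess_sup_inf.
From mathcomp Require finmap.
From mathcomp Require Import ring lra.
Import Order.TTheory GRing.Theory Num.Theory.
Import numFieldNormedType.Exports.

Set Implicit Arguments.
Unset Strict Implicit.
Unset Printing Implicit Defensive.

Local Open Scope classical_set_scope.
Local Open Scope ring_scope.

(** The proof is a De Giorgi iteration whose only analytic input is an elementary
    isoperimetric observation.  Passing to Borel representatives and replacing u
    by - u, everything reduces to a Borel subsolution u near one point x0 of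
    Omega; balls of the sup norm (cubes) are used throughout, and enorm is
    compared with the sup norm.

    _The cut energy._  Let A have small measure, let x be in A and let
    (2 rho)^n = 2 |A|.  At least half of the cube of radius rho around x lies
    outside A, and there the kernel is at least a constant times
    rho^(- (n + s q)) if q is a lower bound of the exponent; hence the integral
    of the kernel over that part is at least c rho^(- s q)
    ([cut_energy_lower]).  With A = {u > k} this bounds the measure of higher
    level sets by the energy carried by the pairs (x, y) with u x > k >= u y,
    with a gain of a power of |A|.

    _Caccioppoli inequality._  Testing the equation with (u - k)_+ eta^m, only
    those cut pairs have to be kept on the good side.  The pairs with both
    values above k contribute an error that is controlled near the diagonal by
    (u - k)_+^p |x - y|^p and away from it by the tail of u ([flux_lower],
    [err_integral], [caccioppoli]).  That the test function is admissible also
    rests on the tail ([test_phi_diff]): p (x, y) for x far away is unrelated to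
    the exponents near x0, and u need not be integrable to that power.

    _The variable exponent._  As p is merely continuous, on a small cube it
    ranges over an interval [q1, q2] that is short compared with s / n.  The good
    side of the Caccioppoli inequality controls powers q1, the bad one needs
    powers q2.  The cut energy applied to u itself first gives local
    integrability of u_+^q for some q > q2 ([higher_integrability]), and the
    mismatch then costs only a small negative power of rho, less than what the
    isoperimetric gain provides ([level_mass_le], [one_step]).  Choosing the
    radii rho geometrically makes the integral of (u - k_j)_+^q1 over shrinking
    cubes tend to 0 ([local_upper_bound]). *)

(** * Integration without measurability, and measurability of powers *)

Section general.
Context d (T : measurableType d) (R : realType) (mu : {measure set T -> \bar R}).
Import HBNNSimple.

(** The integral of a nonnegative function is a supremum over the simple functions
    below it, so it is monotone for arbitrary functions; this removes
    measurability side conditions on one side of most estimates. *)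
Lemma ge0_le_integral_total (f g : T -> \bar R) :
  (forall x, (0 <= f x)%E) -> (forall x, (f x <= g x)%E) ->
  (\int[mu]_x f x <= \int[mu]_x g x)%E.
Proof.
move=> f0 fg; rewrite !ge0_integralTE//; last first.
  by move=> x; apply: le_trans (fg x).
apply: le_ereal_sup => _ [h hf <-]; exists h => // x.
exact: le_trans (hf x) (fg x).
Qed.

Let integral_null_le (N : set T) (f g : T -> \bar R) :
  measurable N -> mu N = 0%E -> (forall x, (0 <= g x)%E) -> (forall x, (0 <= f x)%E) ->
  (forall x, ~ N x -> f x = g x) ->
  (\int[mu]_x f x <= \int[mu]_x g x)%E.
Proof.
move=> mN N0 g0 f0 fg; rewrite ge0_integralTE//.
apply: ge_ereal_sup => _ [h hf <-].
rewrite -integralT_nnsfun.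
rewrite (ge0_negligible_integral mN)//; last 2 first.
- by apply/measurable_EFinP.
- by move=> x _; rewrite lee_fin.
rewrite integral_mkcond; apply: ge0_le_integral_total => x.
  by rewrite patchE; case: ifPn => //; rewrite lee_fin.
rewrite patchE; case: ifPn => // /set_mem [_ Nx].
by rewrite -fg.
Qed.

(** Multiplying a simple function below f by the indicator of the complement of N
    does not change its integral and puts it below g.  With this, Lebesgue
    measurable functions are replaced by Borel ones inside iterated integrals. *)
Lemma integral_null_congr (N : set T) (f g : T -> \bar R) :
  measurable N -> mu N = 0%E -> (forall x, ~ N x -> f x = g x) ->
  (\int[mu]_x f x = \int[mu]_x g x)%E.
Proof.
move=> mN N0 fg; rewrite integralE [RHS]integralE; congr (_ - _)%E.
  apply/eqP; rewrite eq_le; apply/andP; split;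
  apply: (integral_null_le mN N0) => // x Nx;
  by rewrite ?funeposE fg.
apply/eqP; rewrite eq_le; apply/andP; split;
  apply: (integral_null_le mN N0) => // x Nx;
  by rewrite ?funenegE fg.
Qed.

Lemma measurable_natb (P : T -> bool) :
  measurable_fun setT P -> measurable_fun setT (fun x => (P x)%:R : R).
Proof.
move=> mP.
rewrite (_ : (fun _ => _) = (fun x => if P x then 1 else 0)).
  exact: measurable_fun_ifT.
by apply/funext => x; case: (P x).
Qed.

Lemma measurable_powR2 (f g : T -> R) :
  measurable_fun setT f -> measurable_fun setT g ->
  measurable_fun setT (fun x => f x `^ g x).
Proof.
move=> mf mg.
rewrite (_ : (fun _ => _) =
  (fun x => if f x == 0 then (if g x == 0 then 1 else 0) else expR (g x * ln (f x)))).
  apply: measurable_fun_ifT.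
  - by apply: measurable_fun_eqr.
  - apply: measurable_fun_ifT => //.
    by apply: measurable_fun_eqr.
  - apply: measurableT_comp => //; apply: measurable_funM => //.
    by apply: measurableT_comp => //; exact: measurable_ln.
apply/funext => x; rewrite /powR; case: ifP => // _; by case: (_ == 0).
Qed.

Lemma measurable_ge0V (f : T -> R) : (forall x, 0 <= f x) ->
  measurable_fun setT f -> measurable_fun setT (fun x => (f x)^-1).
Proof.
move=> f0 mf; rewrite (_ : (fun _ => _) = (fun x => f x `^ (-1))); last first.
  by apply/funext => x; rewrite powR_inv1.
exact: measurable_powR2.
Qed.

End general.

(** * From weak-type bounds to integrability *)

Section weak_type.
Context d (T : measurableType d) (R : realType) (mu : {measure set T -> \bar R}).

Lemma measurable_bset (P : T -> bool) : measurable_fun setT P -> measurable [set x | P x].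
Proof.
by move=> mP; rewrite -[X in measurable X]setTI; exact: (mP measurableT [set true]).
Qed.

Lemma integral_natb (P : T -> bool) : measurable_fun setT P ->
  (\int[mu]_x ((P x)%:R)%:E = mu [set x | P x])%E.
Proof.
move=> mP; rewrite -[in RHS](setIT [set x | P x]).
rewrite -(@integral_indic _ _ _ mu setT measurableT) //; last exact: measurable_bset.
by apply: eq_integral => x _; rewrite indicE mem_setE.
Qed.

Lemma dyadic_level (t0 y : R) : 0 < t0 -> t0 < y ->
  exists i : nat, 2 ^+ i * t0 < y <= 2 ^+ i.+1 * t0.
Proof.
move=> t00 t0y.
have ex : exists i : nat, y <= 2 ^+ i.+1 * t0.
  exists (Num.truncn (y / t0)); rewrite -ler_pdivrMr//.
  have /andP[_ h] := truncn_itv (ltW (divr_gt0 (lt_trans t00 t0y) t00)).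
  apply: (le_trans (ltW h)); rewrite -natrX ler_nat.
  exact: ltnW (ltn_expl _ _).
case: (ex_minnP ex) => i iy imin; exists i; rewrite iy andbT.
case: i iy imin => [|i] iy imin; first by rewrite expr0 mul1r.
rewrite ltNge; apply/negP => h; have := imin _ h.
by rewrite ltnn.
Qed.

(** A weak L^m' bound on a set of finite measure gives an L^m bound for m < m':
    summing (2^(i+1) t0)^m over the dyadic levels 2^i t0 < f <= 2^(i+1) t0 yields
    a geometric series of ratio 2^(m - m').  It serves both for the singular
    kernel and for the higher integrability of u, and the constant is explicit
    because it has to be uniform in the base point of the kernel. *)
Lemma weak_type_bound (D : T -> bool) (f : T -> R) (V C t0 m m' : R) :
  measurable_fun setT D -> measurable_fun setT f -> (forall x, 0 <= f x) ->
  0 <= C -> 0 < t0 -> 0 <= m -> m < m' ->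
  (mu [set x | D x] <= V%:E)%E ->
  (forall t, t0 <= t -> (mu [set x | D x && (t < f x)%R] <= (C * t `^ (- m'))%:E)%E) ->
  (\int[mu]_x ((D x)%:R * f x `^ m)%:E <=
   (t0 `^ m * V + C * t0 `^ (m - m') * 2 `^ m / (1 - 2 `^ (m - m')))%:E)%E.
Proof.
move=> mD mf f0 C0 t00 m0 mm' DV Df.
pose E (i : nat) x := D x && (2 ^+ i * t0 < f x).
have mE i : measurable_fun setT (E i).
  by apply: measurable_and => //; apply: measurable_fun_ltr.
pose F (i : nat) x : \bar R := (((2 ^+ i.+1 * t0) `^ m) * (E i x)%:R)%:E.
have F0 i x : (0 <= F i x)%E by rewrite lee_fin mulr_ge0// powR_ge0.
have mF i : measurable_fun setT (F i).
  by apply/measurable_EFinP/measurable_funM => //; exact: measurable_natb.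
have intb (P : T -> bool) c : measurable_fun setT P -> 0 <= c ->
    (\int[mu]_x (c * (P x)%:R)%:E = c%:E * mu [set x | P x])%E.
  move=> mP c0; under eq_integral do rewrite EFinM.
  rewrite ge0_integralZl_EFin//; last first.
    by apply/measurable_EFinP/measurable_natb.
  by rewrite integral_natb.
set z : R := 2 `^ (m - m').
have z0 : 0 < z by apply: powR_gt0.
have z1 : z < 1.
  rewrite /z -opprB powRN invf_lt1 ?powR_gt0//.
  have h : (1 : R) `^ (m' - m) < 2 `^ (m' - m).
    by apply: gt0_ltr_powR; rewrite ?subr_gt0 ?nnegrE ?ltr1n.
  by rewrite powR1 in h.
set a := C * t0 `^ (m - m') * 2 `^ m.
have a0 : 0 <= a by rewrite !mulr_ge0// powR_ge0.
have intF i : (\int[mu]_x F i x <= (a * z ^+ i)%:E)%E.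
  rewrite intb//; last exact: powR_ge0.
  have t0i : t0 <= 2 ^+ i * t0.
    by rewrite ler_peMl ?(ltW t00)// exprn_ege1// ler1n.
  apply: (@le_trans _ _ (((2 ^+ i.+1 * t0) `^ m)%:E * (C * (2 ^+ i * t0) `^ - m')%:E)%E).
    by rewrite lee_wpmul2l ?lee_fin ?powR_ge0// Df.
  rewrite -EFinM lee_fin le_eqVlt; apply/orP; left; apply/eqP.
  rewrite /a /z !powRM ?(ltW t00)// ?exprn_ge0//.
  rewrite -[2 ^+ i.+1]powR_mulrn// -[2 ^+ i]powR_mulrn//.
  rewrite -[(2 `^ _) ^+ i]powR_mulrn ?powR_ge0// -!powRrM.
  rewrite (_ : i.+1%:R * m = m + i%:R * m); last by rewrite -natr1; ring.
  rewrite powRD ?pnatr_eq0 ?implybT//.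
  rewrite (_ : (m - m') * i%:R = i%:R * m + i%:R * - m'); last by ring.
  rewrite [2 `^ (_ + _)]powRD ?pnatr_eq0 ?implybT//.
  rewrite powRD ?(gt_eqF t00) ?implybT//; ring.
apply: (@le_trans _ _ (\int[mu]_x ((t0 `^ m * (D x)%:R)%:E + \sum_(i <oo) F i x))%E).
  apply: ge0_le_integral_total => x.
    by rewrite lee_fin mulr_ge0// powR_ge0.
  have S0 : (0 <= \sum_(i <oo) F i x)%E by apply: nneseries_ge0.
  have [Dx|Dx] := boolP (D x); last first.
    by rewrite mul0r adde_ge0// lee_fin mulr_ge0// powR_ge0.
  rewrite mul1r mulr1.
  have [fx|fx] := leP (f x) t0.
    by apply: (@le_trans _ _ (t0 `^ m)%:E);
      rewrite ?leeDl// lee_fin ge0_ler_powR// nnegrE// ltW.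
  have [i /andP[fi1 fi2]] := dyadic_level t00 fx.
  apply: (@le_trans _ _ (F i x)).
    rewrite /F /E Dx fi1 mulr1 lee_fin ge0_ler_powR// nnegrE.
    exact: ltW (lt_trans t00 fx).
    exact: le_trans fi2.
  apply: (@le_trans _ _ (\sum_(j <oo) F j x)%E); last first.
    by rewrite leeDr// lee_fin powR_ge0.
  apply: le_trans (nneseries_lim_ge i.+1 _) => //.
  rewrite big_nat_recr//= leeDr// sume_ge0//.
rewrite ge0_integralD//; last 4 first.
- by move=> x _; rewrite lee_fin mulr_ge0// powR_ge0.
- by apply/measurable_EFinP/measurable_funM => //; exact: measurable_natb.
- by move=> x _; exact: nneseries_ge0.
- by apply: ge0_emeasurable_sum => //.
rewrite EFinD leeD//.
  by rewrite intb ?powR_ge0// EFinM lee_wpmul2l// lee_fin powR_ge0.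
rewrite integral_nneseries//.
apply: (@le_trans _ _ (\sum_(i <oo) (a * z ^+ i)%:E)%E).
  apply: lee_nneseries => [i _|i _]; last exact: intF.
  by move=> *; apply: integral_ge0.
apply: lime_le.
  by apply: is_cvg_nneseries => i _ _; rewrite lee_fin mulr_ge0// exprn_ge0// ltW.
apply: nearW => k.
rewrite sumEFin lee_fin -mulr_sumr ler_wpM2l//.
have -> : \sum_(0 <= i < k) z ^+ i = (1 - z ^+ k) / (1 - z).
  have := @geometric_seriesE _ 1 z; rewrite lt_eqF// => /(_ isT) /funeqP /(_ k).
  rewrite /series/= mul1r => <-.
  by apply: eq_bigr => i _; rewrite /geometric/= mul1r.
rewrite ler_pdivrMr ?subr_gt0// mulVf ?gt_eqF ?subr_gt0//.
by rewrite gerBl exprn_ge0// ltW.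
Qed.

End weak_type.

(** * Norms, Borel sets and cubes in R^n *)

Section norms.
Context (R : realType) (n : nat).
Implicit Types x y : 'rV[R]_n.

Lemma norm_rV_lt x (r : R) : 0 < r ->
  (`|x| < r) = [forall i, `|x 0 i| < r].
Proof.
move=> r0; rewrite [`|x|]mx_normrE; apply/bigmax_ltP/forallP => /= [[_ h] i|h].
  exact: (h (0, i)).
by split=> // -[i j] _ /=; rewrite (ord1 i).
Qed.

Lemma norm_rV_le x (r : R) : 0 <= r ->
  (forall i, `|x 0 i| <= r) -> `|x| <= r.
Proof.
move=> r0 h; rewrite [`|x|]mx_normrE; apply/bigmax_leP; split=> // -[i j] _ /=.
by rewrite (ord1 i).
Qed.

Lemma coor_le_norm x i : `|x 0 i| <= `|x|.
Proof.
rewrite [leRHS]mx_normrE.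
exact: (@le_bigmax _ _ _ 0 (fun ij => `|x ij.1 ij.2|) (0, i)).
Qed.

Lemma enorm_ge0 x : 0 <= enorm x. Proof. exact: sqrtr_ge0. Qed.

Lemma norm_le_enorm x : `|x| <= enorm x.
Proof.
apply: norm_rV_le => [|i]; first exact: enorm_ge0.
rewrite -sqrtr_sqr ler_sqrt ?sumr_ge0// => [|j _]; last exact: sqr_ge0.
by rewrite (bigD1 i)//= lerDl sumr_ge0// => j _; exact: sqr_ge0.
Qed.

Lemma enorm_le_norm x : enorm x <= n%:R * `|x|.
Proof.
have h0 : 0 <= n%:R * `|x| by rewrite mulr_ge0.
rewrite -[leRHS]ger0_norm// -sqrtr_sqr ler_sqrt ?sqr_ge0//.
apply: (@le_trans _ _ (\sum_(i < n) `|x| ^+ 2)).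
  apply: ler_sum => i _; rewrite -[x 0 i ^+ 2]ger0_norm ?sqr_ge0// normrX.
  by rewrite lerXn2r ?nnegrE// coor_le_norm.
rewrite sumr_const card_ord exprMn -[leLHS]mulr_natl ler_wpM2r ?sqr_ge0//.
by rewrite -natrX ler_nat; case: n => // k; rewrite leq_pmulr.
Qed.

Lemma enormN x : enorm (- x) = enorm x.
Proof. by congr Num.sqrt; apply: eq_bigr => i _; rewrite mxE sqrrN. Qed.

Lemma enorm_eq0 x : enorm x = 0 -> x = 0.
Proof.
move=> h; apply/eqP; rewrite -normr_eq0 eq_le normr_ge0 andbT -h.
exact: norm_le_enorm.
Qed.

Lemma measurable_norm_rV : measurable_fun setT (fun x => `|x| : R).
Proof.
rewrite (_ : (fun _ => _) = (fun x => \big[Num.max/0]_(i < n) `|x 0 i|)); last first.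
  apply/funext => x; rewrite [LHS]mx_normrE.
  apply/eqP; rewrite eq_le; apply/andP; split.
    apply/bigmax_leP; split; first exact: bigmax_ge_id.
    by move=> [i j] _ /=; rewrite (ord1 i); apply: (le_bigmax 0 (fun i => `|x 0 i|)).
  apply/bigmax_leP; split; first exact: bigmax_ge_id.
  by move=> i _; apply: (le_bigmax 0 (fun ij => `|x ij.1 ij.2|) (0, i)).
move: (index_enum _) => l0; elim: l0 => [|a l ih].
  by rewrite (_ : (fun _ => _) = cst 0)//; apply/funext => x; rewrite big_nil.
rewrite (_ : (fun _ => _) = (fun x => Num.max `|x 0 a| 
    (\big[Num.max/0]_(i <- l) `|x 0 i|))); last first.
  by apply/funext => x; rewrite big_cons.
apply: measurable_maxr => //.
apply: measurableT_comp => //; exact: measurable_coor.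
Qed.

Lemma measurable_enorm : measurable_fun setT (fun x => enorm x : R).
Proof.
rewrite (_ : (fun _ => _) = (fun x => (\sum_(i < n) x 0 i ^+ 2) `^ 2^-1)); last first.
  by apply/funext => x; rewrite powR12_sqrt// sumr_ge0// => i _; exact: sqr_ge0.
apply: measurable_powR2 => //; apply: measurable_sum => i.
by apply: measurable_funX; exact: measurable_coor.
Qed.

End norms.

Section measurable_maps.
Context (R : realType) (n : nat) d (T : measurableType d).

Lemma measurable_rVB (f g : T -> 'rV[R]_n) :
  measurable_fun setT f -> measurable_fun setT g ->
  measurable_fun setT (fun t => f t - g t).
Proof.
move=> mf mg; apply: measurable_fun_rV => i.
under eq_fun do rewrite !mxE.
by apply: measurable_funB; apply: (measurableT_comp (measurable_coor i)).
Qed.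

Lemma measurable_countable_comp (C : countType) (g : T -> C) (h : C -> R) :
  (forall c, measurable (g @^-1` [set c])) -> measurable_fun setT (h \o g).
Proof.
move=> mg _ B mB; rewrite setTI.
rewrite (_ : _ @^-1` B = \bigcup_k (if unpickle k is Some c then
    (if `[< B (h c) >] then g @^-1` [set c] else set0) else set0)); last first.
  apply/seteqP; split => [t Bt|t [k _]].
    by exists (pickle (g t)) => //; rewrite pickleK; case: asboolP.
  by case: unpickle => // c; case: asboolP => // Bc; rewrite /preimage/= => ->.
apply: bigcup_measurable => k _; case: unpickle => // c.
by case: ifP => _; [exact: mg|exact: measurable0].
Qed.

End measurable_maps.

Lemma measurable_cube (R : realType) n (x : 'rV[R]_n) r : measurable [set y | `|y - x| < r].
Proof.
apply: measurable_bset; apply: measurable_fun_ltr => //.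
apply: (measurableT_comp (measurable_norm_rV (n := n))).
by apply: measurable_rVB.
Qed.

Section joint_measurability.
Context (R : realType) (n : nat).
Local Notation Rn := 'rV[R]_n.

(* Points are rounded to the lattice of mesh 1 / (k + 1), a countable set. *)
Let fl (k : nat) (x : Rn) : 'rV[int]_n := \row_i Num.floor (k.+1%:R * x 0 i).
Let gr (k : nat) (c : 'rV[int]_n) : Rn := \row_i ((c 0 i)%:~R / k.+1%:R).

Let fl_dist k (x : Rn) : `|x - gr k (fl k x)| <= k.+1%:R^-1.
Proof.
apply: norm_rV_le => // i; rewrite !mxE.
have k0 : 0 < k.+1%:R :> R by rewrite ltr0n.
have /andP[f1 f2] := floor_itv (k.+1%:R * x 0 i).
rewrite intrD in f2.
rewrite ger0_norm.
  rewrite lerBlDr -[X in _ <= X + _]mul1r -mulrDl ler_pdivlMr// mulrC.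
  by rewrite addrC ltW.
by rewrite subr_ge0 ler_pdivrMr// [leRHS]mulrC.
Qed.

Let fl_cvg (x : Rn) : (fun k => gr k (fl k x)) @ \oo --> x.
Proof.
apply/cvgrPdist_lt => e e0; near=> k.
apply: (le_lt_trans (fl_dist k x)).
by near: k; exact: near_infty_natSinv_lt (PosNum e0).
Unshelve. all: by end_near. Qed.

Let measurable_fl k c : measurable ((fl k) @^-1` [set c]).
Proof.
rewrite (_ : _ @^-1` _ = \big[setI/setT]_(i < n)
   [set x : Rn | (c 0 i)%:~R <= k.+1%:R * x 0 i < (c 0 i + 1)%:~R]); last first.
  rewrite -bigcap_seq; apply/seteqP; split => x /=.
    by move=> <- i _ /=; rewrite mxE floor_itv.
  move=> h; apply/rowP => i; rewrite mxE; apply: floor_def.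
  by apply: h; rewrite /= mem_index_enum.
apply: bigsetI_measurable => i _; apply: measurable_bset.
by apply: measurable_and; [apply: measurable_fun_ler|apply: measurable_fun_ltr] => //;
  apply: measurable_funM => //; exact: measurable_coor.
Qed.

(** The sigma-algebra is generated by coordinates and not by open sets, so
    continuity is used through rounding: the value at rounded points depends on
    countably many cells and converges as the mesh tends to 0. *)
Lemma measurable_continuous2 (p : Rn -> Rn -> R) :
  continuous (fun z : Rn * Rn => p z.1 z.2) ->
  measurable_fun setT (fun z : Rn * Rn => p z.1 z.2).
Proof.
move=> cp.
apply: (@measurable_fun_cvg _ _ _ _
  (fun k (z : Rn * Rn) => p (gr k (fl k z.1)) (gr k (fl k z.2)))).
  move=> k; apply: (@measurable_countable_comp _ _ _ ('rV[int]_n * 'rV[int]_n)%type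
    (fun z : Rn * Rn => (fl k z.1, fl k z.2)) (fun c => p (gr k c.1) (gr k c.2))).
  move=> [c1 c2]; rewrite (_ : _ @^-1` _ =
     (fl k @^-1` [set c1]) `*` (fl k @^-1` [set c2])).
    exact: measurableX.
  by apply/seteqP; split => [[x y] [/= <- <-]|[x y] [/= <- <-]].
move=> [x y] _.
by apply: (@continuous2_cvg _ _ _ _ _ _ _ _ p x y); [exact: (cp (x, y))|exact: fl_cvg|exact: fl_cvg].
Qed.

Lemma measurable_open_rV (O : set Rn) : open O -> measurable O.
Proof.
move=> oO.
pose C k (c : 'rV[int]_n) := [set y : Rn | `|y - gr k c| < 2 / k.+1%:R].
rewrite (_ : O = \bigcup_k \bigcup_j (if unpickle j is Some c then
    (if `[< C k c `<=` O >] then C k c else set0) else set0)).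
  apply: bigcup_measurable => k _; apply: bigcup_measurable => j _.
  case: unpickle => [c|]; last exact: measurable0.
  by case: ifP => _; [exact: measurable_cube|exact: measurable0].
apply/seteqP; split => x; last first.
  move=> [k _ [j _]]; case: unpickle => // c.
  by case: asboolP => // h; exact: h.
move=> Ox; have [r r0 rO] := (nbhs_ballP _ _).1 (open_nbhs_nbhs (conj oO Ox)).
have r3 : 0 < r / 3 by rewrite divr_gt0.
have [k _ kr] := near_infty_natSinv_lt (PosNum r3).
have {}kr : k.+1%:R^-1 < r / 3 := kr k (leqnn _).
have k0 : 0 < k.+1%:R^-1 :> R by rewrite invr_gt0 ltr0n.
have xC := fl_dist k x.
exists k => //; exists (pickle (fl k x)) => //; rewrite pickleK.
case: asboolP => [_|]; first by rewrite /C/=; set e := k.+1%:R^-1 in xC k0 *; lra.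
case=> y; rewrite /C/= => yC; apply: rO; rewrite -ball_normE/=.
rewrite (_ : x - y = (x - gr k (fl k x)) - (y - gr k (fl k x))); last first.
  by rewrite opprB addrA subrK.
apply: (le_lt_trans (ler_normB _ _)).
set e := k.+1%:R^-1 in xC k0 kr yC; lra.
Qed.

End joint_measurability.

Section cube_measure.
Context (R : realType).

(** The measure is defined by peeling off the first coordinate, and so is a cube. *)
Lemma lebesgue_rV_cube n (x : 'rV[R]_n) r : 0 < r ->
  lebesgue_rV n [set y | `|y - x| < r] = ((2 * r) ^+ n)%:E.
Proof.
move=> r0; elim: n x => [|n ih] x.
  rewrite /= diracE mem_set//=.
  by rewrite norm_rV_lt//; apply/forallP => -[].
have -> : lebesgue_rV n.+1 [set y | `|y - x| < r] =
   (@lebesgue_measure R \x @lebesgue_rV R n)%E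
     ((ball (x 0 0) r : set (measurableTypeR R)) `*`
      [set y | `|y - \row_j x 0 (lift ord0 j)| < r]).
  rewrite /= /lebesgue_step /pushforward; congr (_ _).
  apply/seteqP; split => -[a v] /=.
    rewrite norm_rV_lt// => /forallP h; split.
      by rewrite /ball/= distrC; have := h 0; rewrite !mxE /=; case: splitP => // j _; rewrite mxE.
    rewrite norm_rV_lt//; apply/forallP => j.
    have := h (lift ord0 j); rewrite !mxE/=; case: splitP => //= k.
      by rewrite (ord1 k).
    by rewrite /bump/= => -[] jk; rewrite (_ : k = j)//; exact/val_inj.
  rewrite /ball/= distrC => -[h1]; rewrite !norm_rV_lt// => /forallP h2.
  apply/forallP => i; rewrite !mxE; case: splitP => k ik.
    by rewrite mxE (_ : i = 0)//; apply/val_inj; rewrite /= ik (ord1 k).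
  have := h2 k; rewrite !mxE (_ : lift ord0 k = i)//.
  by apply/val_inj; rewrite /= ik.
rewrite product_measure1E//; last exact: measurable_cube.
  rewrite ih [X in (X * _)%E](_ : _ = (r *+ 2)%:E).
    by rewrite exprS EFinM mulr2n mulrDl mul1r.
  by apply: (lebesgue_measure_ball (x 0 0)); exact: ltW.
exact: measurable_ball.
Qed.

End cube_measure.

(** * Pointwise inequalities for the flux *)

Section scalar.
Context (R : realType).
Implicit Types a b k pp L x y : R.

Lemma ler_powR_base a b pp : 0 <= pp -> 0 <= a -> a <= b -> a `^ pp <= b `^ pp.
Proof. by move=> p0 a0 ab; apply: ge0_ler_powR => //; rewrite nnegrE// (le_trans a0). Qed.

Lemma powRD_le a b pp P : 0 <= a -> 0 <= b -> 0 <= pp -> pp <= P ->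
  (a + b) `^ pp <= 2 `^ P * (a `^ pp + b `^ pp).
Proof.
move=> a0 b0 pp0 ppP.
wlog ab : a b a0 b0 / a <= b.
  move=> h; have [/h|/ltW/h] := leP a b; first exact.
  by rewrite addrC [X in _ * X]addrC; apply.
apply: (@le_trans _ _ ((2 * b) `^ pp)).
  by apply: ler_powR_base => //; [lra|lra].
rewrite powRM//; apply: ler_pM; rewrite ?powR_ge0//.
  by apply: ler_powR => //; rewrite ler1n.
by rewrite lerDr powR_ge0.
Qed.

Lemma powR_predM a pp : 0 <= a -> 0 < pp -> a `^ (pp - 1) * a = a `^ pp.
Proof. by move=> a0 p0; rewrite mulrC mulr_powRB1. Qed.

Lemma young_max a b pp : 0 <= a -> 0 <= b -> 1 <= pp ->
  a `^ (pp - 1) * b <= a `^ pp + b `^ pp.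
Proof.
move=> a0 b0 p1; have [ab|/ltW ba] := leP a b.
  apply: (@le_trans _ _ (b `^ pp)); last by rewrite lerDr powR_ge0.
  rewrite -(@powR_predM b pp)//; last lra.
  by rewrite ler_wpM2r// ler_powR_base// subr_ge0.
apply: (@le_trans _ _ (a `^ pp)); last by rewrite lerDl powR_ge0.
rewrite -(@powR_predM a pp)//; last lra.
by rewrite ler_wpM2l// powR_ge0.
Qed.

Lemma flux_pos (t : R) pp : 0 < t -> `|t| `^ (pp - 2) * t = t `^ (pp - 1).
Proof.
move=> t0; rewrite gtr0_norm// -[X in _ * X]powRr1 ?ltW// -powRD; last first.
  by apply/implyP => _; rewrite gt_eqF.
by congr (_ `^ _); ring.
Qed.

Lemma abs_flux (t : R) pp : `|t| `^ (pp - 2) * `|t| <= `|t| `^ (pp - 1).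
Proof.
have [->|t0] := eqVneq t 0; first by rewrite normr0 mulr0 powR_ge0.
have t0' : 0 < `|t| by rewrite normr_gt0.
by have := flux_pos pp t0'; rewrite normr_id => ->.
Qed.

Definition above k a := Num.max 0 (a - k).

Lemma above_ge0 k a : 0 <= above k a. Proof. by rewrite le_max lexx. Qed.
Lemma above_le0 k a : a <= k -> above k a = 0.
Proof. by move=> ak; apply/max_idPl; lra. Qed.
Lemma above_ge k a : k <= a -> above k a = a - k.
Proof. by move=> ak; apply/max_idPr; lra. Qed.
Lemma above_lip k a b : `|above k a - above k b| <= `|a - b|.
Proof.
wlog ab : a b / b <= a.
  move=> h; have [/h|/ltW/h] := leP b a; first exact.
  by rewrite distrC [leRHS]distrC.
rewrite [leRHS]ger0_norm ?subr_ge0//.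
have [ak|/ltW ak] := leP a k.
  by rewrite !above_le0 ?subrr ?normr0 ?subr_ge0//; lra.
have [bk|/ltW bk] := leP b k.
  by rewrite (above_ge ak) (above_le0 bk) ger0_norm; lra.
by rewrite !above_ge// ger0_norm; lra.
Qed.
Lemma above_le_pos k a : 0 <= k -> above k a <= Num.max 0 a.
Proof.
by move=> k0; rewrite ge_max !le_max lexx/=; apply/orP; right; lra.
Qed.

(** In this section a = u x >= b = u y, while X and Y are the values at x and y of the
    cut-off function; J is the flux of the equation paired with the test
    function (u - k)_+ eta^m, without the kernel. *)
Section flux.
Variables (k a b X Y pp : R) (m : nat).
Hypotheses (ba : b <= a) (X01 : 0 <= X <= 1) (Y01 : 0 <= Y <= 1).
Hypotheses (pp1 : 1 < pp) (ppm : pp <= m%:R).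

Let J := `|a - b| `^ (pp - 2) * (a - b) * (above k a * X ^+ m - above k b * Y ^+ m).
Let pp0 : 0 < pp. Proof. exact: lt_trans ltr01 pp1. Qed.
Let X0 : 0 <= X. Proof. by case/andP: X01. Qed.
Let Y0 : 0 <= Y. Proof. by case/andP: Y01. Qed.

(** No error occurs when b <= k, where the test function vanishes at y, nor when
    the cut-off function is larger at the point where u is larger. *)
Lemma flux_ge_cut : (b <= k) || (Y <= X) ->
  above k a `^ pp * X ^+ m * (b <= k)%R%:R <= J.
Proof.
move: (ba) (pp1) => ba' pp1'.
have [ak|ka] := leP a k.
  rewrite /J !above_le0 ?(le_trans ba)// => _.
  by rewrite powR0 ?(gt_eqF (lt_trans _ pp1))// !mul0r subr0 mulr0.
have [bk _|kb /= YX] := leP b k.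
  rewrite /J (above_le0 bk) mul0r subr0 mulr1 flux_pos; last lra.
  rewrite -(@powR_predM (above k a) pp) ?above_ge0//.
  rewrite -mulrA ler_wpM2r ?mulr_ge0 ?above_ge0 ?exprn_ge0//.
  by rewrite ler_powR_base ?above_ge0 ?(subr_ge0 1) ?(ltW pp1)// (above_ge (ltW ka)); lra.
rewrite mulr0 /J; have [->|ab] := eqVneq a b; first by rewrite subrr mulr0 mul0r.
rewrite flux_pos; last by rewrite subr_gt0 lt_neqAle eq_sym ab.
rewrite mulr_ge0 ?powR_ge0// subr_ge0 ler_pM ?above_ge0 ?exprn_ge0//.
  by rewrite !above_ge ?ltW//; lra.
by rewrite lerXn2r ?nnegrE.
Qed.

(** The only bad case: the cut-off function increases towards the point where u is
    smaller.  Writing D = a - b, the flux is at least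
    D^(pp - 1) Y^(m - 1) (D Y - Z) with Z = m (a - k) L; either D Y >= Z and it is
    nonnegative, or D Y < Z and Y^(m - 1) <= Y^(pp - 1) bounds the loss by Z^pp.
    This is where m >= pp is needed. *)
Lemma flux_ge_inside L : k < b -> X < Y -> `|X - Y| <= L ->
  - (m%:R * above k a * L) `^ pp <= J.
Proof.
move: (ba) (pp1) => ba' pp1'.
move=> kb XY XYL; rewrite /J.
have [->|ab] := eqVneq a b; first by rewrite subrr mulr0 mul0r oppr_le0 powR_ge0.
have ab' : b < a by rewrite lt_neqAle eq_sym ab.
rewrite flux_pos ?subr_gt0// (above_ge (ltW kb)) (above_ge (ltW (lt_trans kb ab'))).
set w := a - k; set D := a - b.
have D0 : 0 < D by rewrite subr_gt0.
have w0 : 0 < w by rewrite subr_gt0 (lt_trans kb).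
have m0 : (0 < m)%N.
  by rewrite -(ltr_nat R) (lt_trans _ (lt_le_trans pp1 ppm)).
have L0 : 0 <= L by apply: le_trans XYL.
have Y0' : 0 < Y by apply: le_lt_trans XY.
have hXY : Y ^+ m - X ^+ m <= m%:R * Y ^+ m.-1 * L.
  rewrite subrXX mulrC ler_pM ?subr_ge0 ?(ltW XY)//.
  - by apply: sumr_ge0 => i _; rewrite mulr_ge0 ?exprn_ge0.
  - rewrite mulr_natl -[X in _ *+ X](card_ord m) -sumr_const.
    apply: ler_sum => i _.
    have im : (i <= m.-1)%N by rewrite -ltnS prednK.
    rewrite -[X in _ <= Y ^+ X](subnK im) exprD ler_wpM2l ?exprn_ge0//.
    by rewrite lerXn2r ?nnegrE ?X0 ?Y0 ?(ltW XY).
  - by rewrite -[leLHS]opprB -ltr0_norm ?subr_lt0.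
set Z := m%:R * w * L.
have Z0 : 0 <= Z by rewrite !mulr_ge0// ltW.
have step : D `^ (pp - 1) * (D * Y ^+ m - Y ^+ m.-1 * Z) <=
   D `^ (pp - 1) * (w * X ^+ m - (b - k) * Y ^+ m).
  rewrite ler_wpM2l ?powR_ge0//.
  have -> : b - k = w - D by rewrite /w /D; ring.
  have := ler_wpM2l (ltW w0) hXY; rewrite /Z => h.
  have -> : Y ^+ m.-1 * (m%:R * w * L) = w * (m%:R * Y ^+ m.-1 * L) by ring.
  lra.
apply: le_trans step.
have [ZD|DZ] := leP Z (D * Y).
  apply: (@le_trans _ _ 0); first by rewrite oppr_le0 powR_ge0.
  rewrite mulr_ge0 ?powR_ge0// subr_ge0 -(prednK m0) exprS/= mulrA [leRHS]mulrC.
  by rewrite ler_wpM2l ?exprn_ge0.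
apply: (@le_trans _ _ (- (D `^ (pp - 1) * (Y ^+ m.-1 * Z)))); last first.
  by rewrite mulrBr lerBrDr addNr mulr_ge0 ?powR_ge0// mulr_ge0 ?exprn_ge0// ltW.
rewrite lerN2 -(@powR_predM Z pp)//.
rewrite mulrA ler_wpM2r//.
apply: (@le_trans _ _ ((D * Y) `^ (pp - 1))).
  rewrite powRM ?(ltW D0)// ler_wpM2l ?powR_ge0// -powR_mulrn//.
  apply: ger_powR; first by rewrite Y0'; case/andP: Y01.
  by rewrite -subn1 natrB// lerB.
by rewrite ler_powR_base ?mulr_ge0 ?ltW//; lra.
Qed.

(** Here x is outside the support of the cut-off function, possibly far away; the
    power pp - 1 of u x is exactly what the tail controls. *)
Lemma flux_ge_outside : 0 <= k -> X = 0 -> k < b ->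
  - (Num.max 0 a `^ (pp - 1) * above k b) <= J.
Proof.
move: (ba) (pp1) => ba' pp1'.
move=> k0 x0 kb.
have m0 : (0 < m)%N.
  by rewrite -(ltr_nat R) (lt_trans _ (lt_le_trans pp1 ppm)).
rewrite /J x0 expr0n gtn_eqF//= mulr0 sub0r mulrN lerN2.
have [->|ab] := eqVneq a b.
  by rewrite subrr mulr0 mul0r mulr_ge0 ?powR_ge0 ?above_ge0.
have ab' : b < a by rewrite lt_neqAle eq_sym ab.
rewrite flux_pos ?subr_gt0// ler_pM ?powR_ge0 ?mulr_ge0 ?above_ge0 ?exprn_ge0//.
  by apply: ler_powR_base; [rewrite subr_ge0 ltW|rewrite subr_ge0 ltW|
    rewrite le_max; apply/orP; right; lra].
by rewrite ler_piMr ?above_ge0// exprn_ile1//; case/andP: Y01.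
Qed.

End flux.
End scalar.

(** * The kernel *)

(** The standing assumptions on s and p, with joint measurability in place of
    continuity; continuity enters through the oscillation of p on small cubes. *)
Record admissible (R : realType) (n : nat) (s : R) (p : 'rV[R]_n -> 'rV[R]_n -> R)
    (P : R) : Prop := Admissible {
  adm_n : (0 < n)%N;
  adm_s0 : 0 < s;
  adm_s1 : s < 1;
  adm_meas : measurable_fun setT (fun z : 'rV[R]_n * 'rV[R]_n => p z.1 z.2);
  adm_sym : forall x y, p x y = p y x;
  adm_gt1 : forall x y, 1 < p x y;
  adm_le : forall x y, p x y <= P }.

Section kernel.
Context (R : realType) (n : nat) (s : R) (p : 'rV[R]_n -> 'rV[R]_n -> R) (P : R).
Hypothesis H : admissible s p P.
Local Notation Rn := 'rV[R]_n.
Local Notation mu := (@lebesgue_rV R n).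
Local Notation K := (kernel_denom s p).
Implicit Types x y : Rn.

Let n0 : (0 < n)%N := adm_n H.
Let s0 : 0 < s := adm_s0 H.
Let s1 : s < 1 := adm_s1 H.
Let p1 x y : 1 < p x y := adm_gt1 H x y.
Let pP x y : p x y <= P := adm_le H x y.
Let n1 : 1 <= n%:R :> R. Proof. by rewrite ler1n. Qed.
Let P1 : 1 < P. Proof. exact: lt_le_trans (p1 0 0) (pP 0 0). Qed.

Lemma kernel_exponent_gt0 x y : 0 < n%:R + s * p x y.
Proof. by rewrite addr_gt0 ?ltr0n// mulr_gt0// (lt_trans _ (p1 x y)). Qed.

Lemma kernel_denom_ge0 x y : 0 <= K x y. Proof. exact: powR_ge0. Qed.

Lemma enorm_sym x y : enorm (x - y) = enorm (y - x).
Proof. by rewrite -opprB enormN. Qed.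

Lemma kernel_denom_sym x y : K x y = K y x.
Proof. by rewrite /kernel_denom enorm_sym (adm_sym H). Qed.

Lemma measurable_dist : measurable_fun setT (fun z : Rn * Rn => enorm (z.1 - z.2)).
Proof.
apply: (measurableT_comp (@measurable_enorm R n)).
by apply: measurable_rVB.
Qed.

Lemma measurable_kernel_denom : measurable_fun setT (fun z : Rn * Rn => K z.1 z.2).
Proof.
apply: measurable_powR2; first exact: measurable_dist.
apply: measurable_funD => //; apply: measurable_funM => //; exact: (adm_meas H).
Qed.

Lemma measurable_in_cube x (r : R) : measurable_fun setT (fun y : Rn => `|y - x| < r).
Proof.
apply: measurable_fun_ltr => //.
apply: (measurableT_comp (measurable_norm_rV (n := n))).
by apply: measurable_rVB.
Qed.

(** The function enorm (x - y)^-1 is in weak L^n, uniformly in x. *)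
Lemma near_kernel_integral : exists C : R, 0 <= C /\ forall x,
  (\int[mu]_y ((`|y - x| < 1)%R%:R * (enorm (x - y))^-1 `^ (n%:R - (1 - s)))%:E <= C%:E)%E.
Proof.
have m0 : 0 <= n%:R - (1 - s) :> R by move: n1 s0; lra.
have mm : n%:R - (1 - s) < n%:R :> R by move: s1; lra.
eexists; split; last first.
  move=> x; apply: (@weak_type_bound _ _ _ mu _ _ (2 ^+ n) (2 ^+ n) 1 _ n%:R) => //.
  - exact: measurable_in_cube.
  - apply: measurable_ge0V; first by move=> y; exact: enorm_ge0.
    apply: (measurableT_comp (@measurable_enorm R n)).
    by apply: measurable_rVB.
  - by move=> y; rewrite invr_ge0 enorm_ge0.
  - by rewrite /= lebesgue_rV_cube// mulr1.
  move=> t t1; have t0 : 0 < t by lra.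
  apply: (@le_trans _ _ (mu [set y | `|y - x| < t^-1])).
    apply: le_measure; rewrite ?inE; last 2 first.
    - exact: measurable_cube.
    - move=> y /= /andP[_ h].
      have e0 : 0 < enorm (x - y).
        rewrite lt_neqAle enorm_ge0 andbT eq_sym; apply/eqP => e0.
        by move: h; rewrite e0 invr0; lra.
      rewrite distrC (le_lt_trans (norm_le_enorm _))//.
      by rewrite -[ltLHS]invrK ltf_pV2// posrE ?invr_gt0.
    - apply: measurable_bset; apply: measurable_and; first exact: measurable_in_cube.
      apply: measurable_fun_ltr => //; apply: measurable_ge0V; first by move=> y; exact: enorm_ge0.
      apply: (measurableT_comp (@measurable_enorm R n)).
      by apply: measurable_rVB.
  rewrite lebesgue_rV_cube ?invr_gt0// lee_fin exprMn exprVn powRN powR_mulrn//.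
  exact: ltW.
rewrite !powR1 mul1r mulr1 addr_ge0 ?exprn_ge0// !mulr_ge0 ?powR_ge0 ?exprn_ge0//.
rewrite invr_ge0 subr_ge0.
have -> : n%:R - (1 - s) - n%:R = - (1 - s) by ring.
rewrite powRN invf_le1 ?powR_gt0// -[leLHS](powRr0 (2:R)).
by apply: ler_powR; [rewrite ler1n|move: s1; lra].
Qed.

(** For points at distance at most 1 the factor |x - y|^p leaves the exponent
    (1 - s) p - n >= (1 - s) - n, which is integrable; G and w stand for the
    Lipschitz constant of the cut-off and the height of u above the level. *)
Lemma near_kernel_quotient x y (w G : R) : enorm (x - y) <= 1 -> 0 <= w -> 1 <= G ->
  (G * w * enorm (x - y)) `^ p x y / K x y <=
  G `^ P * w `^ p x y * (enorm (x - y))^-1 `^ (n%:R - (1 - s)).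
Proof.
move=> e1 w0 G1; rewrite /kernel_denom; set e := enorm _ in e1 *.
have pp0 : 0 < p x y by exact: lt_trans ltr01 (p1 x y).
have e0 : 0 <= e by exact: enorm_ge0.
have rhs0 : 0 <= G `^ P * w `^ p x y * e^-1 `^ (n%:R - (1 - s)).
  by rewrite !mulr_ge0 ?powR_ge0.
have [ez|enz] := eqVneq e 0.
  by move: rhs0; rewrite ez => rhs0; rewrite mulr0 (@powR0 _ (p x y)) ?gt_eqF// mul0r.
have ep : 0 < e by rewrite lt_neqAle eq_sym enz.
rewrite !powRM ?mulr_ge0//; [|lra|lra].
rewrite -!mulrA.
apply: ler_pM; rewrite ?powR_ge0 ?mulr_ge0 ?invr_ge0 ?powR_ge0//.
  by apply: ler_powR.
rewrite ler_wpM2l ?powR_ge0//.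
rewrite -powRB ?enz ?implybT// -[e^-1]powR_inv1// -powRrM mulN1r.
apply: ger_powR; first by rewrite ep.
have := p1 x y; have := s1.
move=> h1 h2; have : 0 <= (1 - s) * (p x y - 1) by rewrite mulr_ge0; lra.
lra.
Qed.

(** Away from the diagonal the kernel is comparable to the weight of the tail, with
    a constant that is a fixed power of the inverse distance. *)
Lemma far_kernel x y (dl Lam : R) : 0 < dl -> dl <= 1 -> 0 <= Lam -> `|y| <= Lam ->
  dl <= enorm (x - y) ->
  (K x y)^-1 <= 2 * (n%:R * (1 + Lam) / dl) `^ (n%:R + P) /
                (1 + enorm x `^ (n%:R + s * p y x)).
Proof.
move=> d0 d1 L0 yL de; rewrite (adm_sym H y x).
set e := enorm (x - y) in de; set G := n%:R * (1 + Lam) / dl.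
have N0 := kernel_exponent_gt0 x y.
have G1 : 1 <= G.
  rewrite /G ler_pdivlMr// mul1r (le_trans d1)// -[leLHS]mulr1 ler_pM//; lra.
have e0 : 0 < e by lra.
have ee : enorm x <= G * e.
  apply: (le_trans (enorm_le_norm _)).
  rewrite /G -2!mulrA ler_wpM2l// [dl^-1 * e]mulrC.
  apply: (@le_trans _ _ (e + Lam)).
    rewrite -[x](subrK y) (le_trans (ler_normD _ _))// lerD//.
    exact: norm_le_enorm.
  have h : 1 <= e / dl by rewrite ler_pdivlMr// mul1r.
  have h2 : e <= e / dl by rewrite ler_pdivlMr// ler_piMr// ltW.
  rewrite mulrDl mul1r lerD// ler_peMr//.
have eG : 1 <= G * e.
  rewrite /G mulrAC ler_pdivlMr// mul1r (le_trans de)//.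
  rewrite ler_peMl ?(ltW e0)// -[leLHS]mulr1 ler_pM//; lra.
rewrite ler_pdivlMr; last by rewrite ltr_pwDl ?powR_ge0.
rewrite mulrC ler_pdivrMr ?powR_gt0//.
apply: (@le_trans _ _ (2 * (G * e) `^ (n%:R + s * p x y))).
  rewrite mulr2n mulrDl mul1r lerD//.
    rewrite -[leLHS](powRr0 (G * e)); apply: ler_powR => //; exact: ltW.
  by apply: ler_powR_base => //; [exact: ltW|exact: enorm_ge0].
rewrite powRM ?(ltW e0)//; last lra.
rewrite -mulrA ler_wpM2l// ler_wpM2r ?powR_ge0//.
apply: ler_powR => //; rewrite lerD2l (le_trans _ (pP x y))//.
rewrite -[leRHS]mul1r ler_wpM2r ?(ltW s1)//.
exact: ltW (lt_trans ltr01 (p1 x y)).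
Qed.

(** Half the volume 2^n of a cube of radius 1, times n^(- (n + s P)), which compensates
    enorm <= n * sup norm. *)
Definition cut_const : R := 2 ^+ n / 2 * n%:R `^ (- (n%:R + s * P)).

Lemma cut_const_gt0 : 0 < cut_const.
Proof. by rewrite mulr_gt0 ?powR_gt0 ?divr_gt0 ?exprn_gt0// ltr0n. Qed.

(** The isoperimetric step.  At least half of the cube of radius rho around x lies
    outside the small set A; integrating over it the lower bound F for G and
    (n rho)^(- (n + s q)) for the kernel gives the factor rho^(- s q).  As x is
    in A, the diagonal is avoided. *)
Lemma cut_energy_lower x (rho q F : R) (A : Rn -> bool) (G : Rn -> R) :
  0 < rho -> n%:R * rho <= 1 -> measurable_fun setT A ->
  (mu [set y | A y] <= ((2 * rho) ^+ n / 2)%:E)%E -> A x ->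
  0 <= q -> (forall y, `|y - x| < rho -> q <= p x y) ->
  0 <= F -> (forall y, 0 <= G y) ->
  (forall y, ~~ A y -> `|y - x| < rho -> F <= G y) ->
  ((F * (cut_const * rho `^ (- (s * q))))%:E <= \int[mu]_y (G y / K x y)%:E)%E.
Proof.
move=> r0 nr mA Asmall Ax q0 pq F0 G0 FG.
have n00 : 0 < n%:R :> R by rewrite ltr0n.
have qP : q <= P by rewrite (le_trans (pq x _) (pP x x))// subrr normr0.
pose c := F * (n%:R * rho) `^ (- (n%:R + s * q)).
have c0 : 0 <= c by rewrite mulr_ge0 ?powR_ge0.
pose B y := (`|y - x| < rho) && ~~ A y.
have mB : measurable_fun setT B.
  apply: measurable_and; first exact: measurable_in_cube.
  exact: measurableT_comp.
apply: (@le_trans _ _ (\int[mu]_y (c%:E * ((B y)%:R : R)%:E)))%E; last first.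
  apply: ge0_le_integral_total => y.
    by rewrite -EFinM lee_fin mulr_ge0.
  rewrite -EFinM lee_fin; have [/andP[yx Ay]|_] := boolP (B y); last first.
    by rewrite mulr0 divr_ge0 ?kernel_denom_ge0.
  rewrite mulr1; apply: ler_pM; rewrite ?powR_ge0 ?FG//.
  have e0 : 0 < enorm (x - y).
    rewrite lt_neqAle enorm_ge0 andbT eq_sym; apply/eqP => /enorm_eq0/eqP.
    by rewrite subr_eq0 => /eqP xy; move: Ay; rewrite -xy Ax.
  have enr : enorm (x - y) <= n%:R * rho.
    by apply: (le_trans (enorm_le_norm _)); rewrite ler_wpM2l// distrC ltW.
  rewrite powRN lef_pV2 ?posrE ?powR_gt0 ?mulr_gt0//.
  apply: (@le_trans _ _ (enorm (x - y) `^ (n%:R + s * q))).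
    apply: ger_powR; first by rewrite e0 (le_trans enr).
    by rewrite lerD2l ler_wpM2l ?(ltW s0)// pq.
  apply: ler_powR_base => //; last exact: ltW.
  by rewrite addr_ge0// mulr_ge0// ltW.
rewrite ge0_integralZl_EFin//; last first.
  by apply/measurable_EFinP/measurable_natb.
rewrite integral_natb//.
have muB : (((2 * rho) ^+ n / 2)%:E <= mu [set y | B y])%E.
  rewrite (_ : [set y | B y] = [set y | `|y - x| < rho] `\` [set y | A y]); last first.
    by apply/seteqP; split => y /=; [move=> /andP[? /negP]|move=> [h /negP ?]; rewrite /B h].
  rewrite measureD; last 3 first.
  - exact: measurable_cube.
  - exact: measurable_bset.
  - by rewrite [X in (X < _)%E]lebesgue_rV_cube// ltry.
  rewrite [X in (_ <= X - _)%E]lebesgue_rV_cube// leeBrDr; last first.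
    rewrite ge0_fin_numE//; apply: le_lt_trans (ltry ((2 * rho) ^+ n / 2)).
    apply: le_trans Asmall; apply: le_measure; rewrite ?inE//.
    - apply: measurableI; [exact: measurable_cube|exact: measurable_bset].
    - exact: measurable_bset.
  apply: (@le_trans _ _ (((2 * rho) ^+ n / 2)%:E + ((2 * rho) ^+ n / 2)%:E)%E).
    rewrite leeD2l// (le_trans _ Asmall)//; apply: le_measure; rewrite ?inE//.
    - apply: measurableI; [exact: measurable_cube|exact: measurable_bset].
    - exact: measurable_bset.
  by rewrite -EFinD lee_fin -splitr.
apply: le_trans (lee_wpmul2l _ muB); last by rewrite lee_fin.
rewrite -EFinM lee_fin /c -[leRHS]mulrA ler_wpM2l//.
rewrite powRM ?(ltW r0)// /cut_const exprMn.
rewrite [leRHS](_ : _ = (2 ^+ n / 2 * n%:R `^ (- (n%:R + s * q))) *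
   (rho `^ (- (n%:R + s * q)) * rho ^+ n)); last ring.
rewrite -[rho ^+ n]powR_mulrn ?(ltW r0)// -powRD; last by rewrite (gt_eqF r0) implybT.
rewrite (_ : - (n%:R + s * q) + n%:R = - (s * q)); last ring.
rewrite ler_wpM2r ?powR_ge0// ler_wpM2l ?divr_ge0 ?exprn_ge0//.
by apply: ler_powR => //; rewrite lerN2 lerD2l ler_wpM2l// ltW.
Qed.

End kernel.

(** * Higher integrability *)

Lemma chebyshev_bset d (T : measurableType d) (R : realType)
    (mu : {measure set T -> \bar R}) (A : T -> bool) (c : R) (f : T -> \bar R) :
  measurable_fun setT A -> 0 <= c -> (forall x, (0 <= f x)%E) ->
  (forall x, A x -> (c%:E <= f x)%E) ->
  (c%:E * mu [set x | A x] <= \int[mu]_x f x)%E.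
Proof.
move=> mA c0 f0 Af; rewrite -integral_natb// -ge0_integralZl_EFin//; last first.
  by apply/measurable_EFinP/measurable_natb.
apply: ge0_le_integral_total => x; first by rewrite -EFinM lee_fin mulr_ge0.
case: (boolP (A x)) => [/Af|_]; first by rewrite mule1.
by rewrite mule0.
Qed.

(** u near x0: on the cube of radius r0, which is so small that enorm <= 1 between
    its points, the exponent stays within [q1, q2]; the last two fields say
    that u is in the energy space. *)
Record local_data (R : realType) (n : nat) (s : R) (p : 'rV[R]_n -> 'rV[R]_n -> R)
    (u : 'rV[R]_n -> R) (x0 : 'rV[R]_n) (r0 q1 q2 : R) : Prop := LocalData {
  loc_r0 : 0 < r0;
  loc_small : 2 * n%:R * r0 <= 1;
  loc_meas : measurable_fun setT u;
  loc_q1 : 1 <= q1;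
  loc_osc : forall x y, `|x - x0| < r0 -> `|y - x0| < r0 -> q1 <= p x y <= q2;
  loc_int : (\int[lebesgue_rV n]_x (`|u x| `^ p x x)%:E < +oo)%E;
  loc_mod : (\int[lebesgue_rV n]_x \int[lebesgue_rV n]_y
     (`|u x - u y| `^ p x y / kernel_denom s p x y)%:E < +oo)%E }.

Section higher_integrability.
Context (R : realType) (n : nat) (s : R) (p : 'rV[R]_n -> 'rV[R]_n -> R) (P : R).
Hypothesis H : admissible s p P.
Local Notation Rn := 'rV[R]_n.
Local Notation mu := (@lebesgue_rV R n).
Local Notation K := (kernel_denom s p).
Context (u : Rn -> R) (x0 : Rn) (r0 q1 q2 : R).
Hypothesis L : local_data s p u x0 r0 q1 q2.

Let ler_norm_in x y (a b : R) : `|x - x0| < a -> `|y - x| < b -> `|y - x0| < a + b.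
Proof.
move=> xa yb; rewrite -[y](subrK x) -addrA (le_lt_trans (ler_normD _ _))//.
by rewrite [ltRHS]addrC ltrD.
Qed.

(** With A = {u > t} the cut energy bounds t^q1 |{u > 2 t}| by rho^(s q1), where
    rho^n is comparable to the trivial bound 1 / t of |A|.  The level sets thus
    decay like t^(- (q1 + s / n)), better than t^(- q1). *)
Lemma higher_integrability (q : R) : 0 <= q -> q < q1 + s / n%:R ->
  exists M : R, 0 <= M /\
  (\int[mu]_x ((`|x - x0| < r0 / 2)%R%:R * (Num.max 0 (u x)) `^ q)%:E <= M%:E)%E.
Proof.
case: L => r00 small mu_ q1_1 osc int_fin mod_fin q0 qq.
have n0 : (0 < n)%N := adm_n H; have s0 : 0 < s := adm_s0 H.
have nR : 0 < n%:R :> R by rewrite ltr0n.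
have nR1 : 1 <= n%:R :> R by rewrite ler1n.
have q1_0 : 0 < q1 by lra.
pose M1 := fine (\int[mu]_x (`|u x| `^ p x x)%:E)%E.
pose E0 := fine (\int[mu]_x \int[mu]_y (`|u x - u y| `^ p x y / K x y)%:E)%E.
have M1E : (M1%:E = \int[mu]_x (`|u x| `^ p x x)%:E)%E.
  rewrite fineK// ge0_fin_numE//; apply: integral_ge0 => x _; exact: powR_ge0.
have in0 x : (0 <= \int[mu]_y (`|u x - u y| `^ p x y / K x y)%:E)%E.
  by apply: integral_ge0 => y _; rewrite lee_fin divr_ge0 ?powR_ge0.
have E0E : (E0%:E = \int[mu]_x \int[mu]_y (`|u x - u y| `^ p x y / K x y)%:E)%E.
  by rewrite fineK// ge0_fin_numE//; apply: integral_ge0 => x _.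
have M10 : 0 <= M1 by rewrite -lee_fin M1E; apply: integral_ge0 => x _; exact: powR_ge0.
have E00 : 0 <= E0 by rewrite -lee_fin E0E; apply: integral_ge0 => x _.
pose C := 1 + M1; have C1 : 1 <= C by rewrite lerDl.
(* beyond t0 the radius rho t chosen below is at most r0 / 2 *)
pose t0 := (2 * C / r0) ^+ n.
have t01 : 1 <= t0.
  apply: exprn_ege1; rewrite ler_pdivlMr// mul1r.
  have : 2 * 1 * r0 <= 1.
    by apply: le_trans small; rewrite ler_wpM2r ?(ltW r00)// ler_wpM2l.
  lra.
have mcube r := measurable_in_cube x0 r.
have mgt t : measurable_fun setT (fun x => t < u x) by exact: measurable_fun_ltr.
pose A t x := (`|x - x0| < r0) && (t < u x).
have mA t : measurable_fun setT (A t) by exact: measurable_and.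
have muA t : 1 <= t -> (mu [set x | A t x] <= (M1 / t)%:E)%E.
  move=> t1; have t_0 : 0 < t by lra.
  have h : ((t `^ q1)%:E * mu [set x | A t x] <= M1%:E)%E.
    rewrite M1E; apply: chebyshev_bset; [exact: mA|exact: powR_ge0| |].
      by move=> x; rewrite lee_fin powR_ge0.
    move=> x /andP[xr tu]; rewrite lee_fin.
    have /andP[qp _] := osc _ _ xr xr.
    apply: (@le_trans _ _ (t `^ p x x)); first exact: ler_powR.
    apply: ler_powR_base; [lra|exact: ltW|rewrite ger0_norm; lra].
  rewrite EFinM lee_pdivlMr// muleC; apply: le_trans h.
  rewrite lee_wpmul2r// lee_fin -[leLHS]powRr1 ?(ltW t_0)//.
  exact: ler_powR.
pose rho t := C * t `^ (- n%:R^-1).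
have rho0 t : 0 < t -> 0 < rho t.
  by move=> t_0; rewrite mulr_gt0 ?powR_gt0//; lra.
have rhor t : t0 <= t -> rho t <= r0 / 2.
  move=> t0t; have t_0 : 0 < t by lra.
  have h : 2 * C / r0 <= t `^ n%:R^-1.
    have b0 : 0 <= 2 * C / r0 by rewrite divr_ge0; lra.
    have -> : 2 * C / r0 = t0 `^ n%:R^-1.
      by rewrite /t0 -powR_mulrn// -powRrM mulfV ?powRr1// gt_eqF.
    by apply: ler_powR_base => //; rewrite exprn_ge0.
  rewrite /rho powRN ler_pdivrMr ?powR_gt0// -ler_pdivrMl; last by rewrite divr_gt0.
  by rewrite invf_div mulrAC.
have muB t : t0 <= t -> (mu [set x | ((`|x - x0| < r0 / 2) && (2 * t < u x))%R] <=
    ((E0 / cut_const n s P * C `^ (s * q1)) * t `^ (- (q1 + s / n%:R)))%:E)%E.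
  move=> t0t; have t_1 : 1 <= t by lra. have t_0 : 0 < t by lra.
  have c0 := cut_const_gt0 H.
  pose c := t `^ q1 * (cut_const n s P * rho t `^ (- (s * q1))).
  have cc0 : 0 < c by rewrite !mulr_gt0 ?powR_gt0 ?rho0.
  have h : (c%:E * mu [set x | ((`|x - x0| < r0 / 2) && (2 * t < u x))%R] <= E0%:E)%E.
    rewrite E0E; apply: chebyshev_bset => //; [exact: measurable_and|exact: ltW|].
    move=> x /andP[xr tu].
    apply: (cut_energy_lower H (A := A t) (rho := rho t) (G := fun y => `|u x - u y| `^ p x y)) => //.
    - exact: rho0.
    - apply: (@le_trans _ _ (n%:R * (r0 / 2))); first by rewrite ler_wpM2l// rhor.
      lra.
    - apply: (le_trans (muA _ t_1)); rewrite lee_fin /rho exprMn exprMn.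
      rewrite -[(t `^ _) ^+ n]powR_mulrn ?powR_ge0// -powRrM mulNr mulVf ?gt_eqF//.
      rewrite powR_inv1 ?(ltW t_0)//.
      rewrite (_ : 2 ^+ n * (C ^+ n * t^-1) / 2 = (2 ^+ n / 2 * C ^+ n) / t); last ring.
      rewrite ler_wpM2r ?invr_ge0 ?(ltW t_0)//.
      apply: (@le_trans _ _ C); first by rewrite lerDr.
      have hC : C <= C ^+ n by apply: ler_eXnr.
      have h2 : 2 <= 2 ^+ n :> R by apply: ler_eXnr => //; rewrite ler1n.
      apply: (le_trans hC); rewrite ler_peMl ?exprn_ge0//; first lra.
      by rewrite ler_pdivlMr// mul1r.
    - by rewrite /A (lt_trans xr) ?ltr_pdivrMr//=; lra.
    - exact: ltW.
    - move=> y yx; have xr0 : `|x - x0| < r0 by lra.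
      have yr0 : `|y - x0| < r0.
        by have := ler_norm_in xr yx; have := rhor _ t0t; lra.
      by have /andP[] := osc _ _ xr0 yr0.
    - exact: powR_ge0.
    - move=> y nAy yx; have xr0 : `|x - x0| < r0 by lra.
      have yr0 : `|y - x0| < r0.
        by have := ler_norm_in xr yx; have := rhor _ t0t; lra.
      have /andP[qp _] := osc _ _ xr0 yr0.
      move: nAy; rewrite /A yr0/= -leNgt => uyt.
      apply: (@le_trans _ _ (t `^ p x y)); first exact: ler_powR.
      apply: ler_powR_base; [lra|exact: ltW|].
      by rewrite ger0_norm; lra.
  apply: (@le_trans _ _ (c^-1 * E0)%:E).
    by rewrite EFinM lee_pdivlMl.
  rewrite lee_fin /c [(_ * (_ * _))^-1]invfM [(cut_const _ _ _ * _)^-1]invfM -!powRN opprK /rho.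
  have C0 : 0 <= C by lra.
  rewrite powRM ?powR_ge0// -powRrM.
  rewrite [leLHS](_ : _ = E0 / cut_const n s P * C `^ (s * q1) *
     (t `^ (- q1) * t `^ (- n%:R^-1 * (s * q1)))); last ring.
  rewrite -powRD ?(gt_eqF t_0) ?implybT// ler_wpM2l//.
    by rewrite !mulr_ge0 ?powR_ge0 ?invr_ge0 ?(ltW c0).
  apply: ler_powR => //; rewrite mulNr -opprD lerN2 lerD2l [leRHS]mulrC.
  by rewrite ler_wpM2r ?invr_ge0// ler_peMr// ltW.
pose CC := (E0 / cut_const n s P * C `^ (s * q1)) * 2 `^ (q1 + s / n%:R).
have CC0 : 0 <= CC.
  by rewrite !mulr_ge0 ?powR_ge0 ?invr_ge0// ltW// (cut_const_gt0 H).
pose B := (2 * t0) `^ q * (r0 ^+ n) + CC * (2 * t0) `^ (q - (q1 + s / n%:R)) * 2 `^ q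
   / (1 - 2 `^ (q - (q1 + s / n%:R))).
have W : (\int[mu]_x ((`|x - x0| < r0 / 2)%R%:R * (Num.max 0 (u x)) `^ q)%:E <= B%:E)%E.
  apply: weak_type_bound => //.
  - exact: measurable_maxr.
  - by move=> x; rewrite le_max lexx.
  - by lra.
  - rewrite /= lebesgue_rV_cube; last by rewrite divr_gt0.
    by have -> : 2 * (r0 / 2) = r0 by lra.
  - move=> t tt; have t_0 : 0 < t by lra.
    rewrite (_ : [set x | _] = [set x | (`|x - x0| < r0 / 2) && (2 * (t / 2) < u x)]); last first.
      have -> : 2 * (t / 2) = t by lra.
      apply/seteqP; split => x /= /andP[-> /=];
      by rewrite lt_max (lt_gtF t_0).
    apply: le_trans (muB (t / 2) _) _; first lra.
    rewrite lee_fin powRM ?(ltW t_0)// -[2^-1]powR_inv1// -powRrM mulN1r opprK.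
    by rewrite /CC -!mulrA [X in _ <= _ * (_ * (_ * X))]mulrC.
exists B; split => //; rewrite -lee_fin; apply: le_trans W.
by apply: integral_ge0 => x _; rewrite lee_fin mulr_ge0 ?powR_ge0.
Qed.

End higher_integrability.

(** * Cut-off, test function and error terms *)

Section cutoff.
Context (R : realType) (n : nat).
Local Notation Rn := 'rV[R]_n.
Context (x0 : Rn) (a b : R).
Hypothesis ab : a < b.
Implicit Types x y : Rn.

(** It vanishes already beyond (a + b) / 2, so that its support keeps a distance
    (b - a) / 2 from the complement of the cube of radius b; this is what makes
    the far part of the kernel bounded. *)
Definition cutoff x : R :=
  Num.max 0 (Num.min 1 (((a + b) / 2 - `|x - x0|) * (2 / (b - a)))).

Let d0 : 0 < b - a. Proof. by rewrite subr_gt0. Qed.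

Lemma cutoff01 x : 0 <= cutoff x <= 1.
Proof. by rewrite /cutoff le_max lexx/= ge_max ler01 ge_min lexx. Qed.

Lemma cutoff1 x : `|x - x0| <= a -> cutoff x = 1.
Proof.
move=> xa; rewrite /cutoff (min_idPl _); first exact/max_idPr/ler01.
have ab' := ab.
rewrite mulrA ler_pdivlMr// mul1r; lra.
Qed.

Lemma cutoff0 x : (a + b) / 2 <= `|x - x0| -> cutoff x = 0.
Proof.
move=> xb; rewrite /cutoff; apply/max_idPl; rewrite ge_min; apply/orP; right.
by rewrite pmulr_lle0 ?subr_le0// divr_gt0.
Qed.

Lemma cutoff_lip x y : `|cutoff x - cutoff y| <= 2 / (b - a) * enorm (x - y).
Proof.
have clip (f : R -> R -> R) (c s t : R) : f = Num.max \/ f = Num.min ->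
    `|f c s - f c t| <= `|s - t|.
  have h1 := ler_norm (s - t); have h2 := ler_norm (t - s).
  rewrite distrC in h2; rewrite ler_norml /Num.max /Num.min.
  by move=> [|] ->; repeat (case: ltP => ?); apply/andP; split; lra.
apply: (le_trans (clip _ _ _ _ (or_introl erefl))).
apply: (le_trans (clip _ _ _ _ (or_intror erefl))).
rewrite -mulrBl normrM [leLHS]mulrC ger0_norm ?ler_wpM2l ?divr_ge0 ?(ltW d0)//.
rewrite (_ : _ - _ - _ = `|y - x0| - `|x - x0|); last ring.
apply: (le_trans (ler_dist_dist _ _)).
rewrite (_ : y - x0 - (x - x0) = y - x); last by rewrite opprB addrA subrK.
by rewrite distrC norm_le_enorm.
Qed.

Lemma measurable_cutoff : measurable_fun setT cutoff.
Proof.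
apply: measurable_maxr => //; apply: measurable_minr => //.
apply: measurable_funM => //; apply: measurable_funB => //.
apply: (measurableT_comp (measurable_norm_rV (n := n))).
exact: measurable_rVB.
Qed.
End cutoff.

Section pointwise.
Context (R : realType) (n : nat) (s : R) (p : 'rV[R]_n -> 'rV[R]_n -> R) (P : R).
Hypothesis H : admissible s p P.
Local Notation Rn := 'rV[R]_n.
Context (u : Rn -> R) (x0 : Rn) (a b k : R) (m : nat).
Hypotheses (ab : a < b) (k0 : 0 <= k) (Pm : P <= m%:R).
Implicit Types x y : Rn.

Let p1 x y : 1 < p x y := adm_gt1 H x y.
Let p0 x y : 0 < p x y. Proof. exact: lt_trans ltr01 (p1 x y). Qed.
Let pm x y : p x y <= m%:R. Proof. exact: le_trans (adm_le H x y) Pm. Qed.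

Definition level x := above k (u x).
Definition test_phi x := level x * cutoff x0 a b x ^+ m.

(** The losses of [flux_ge_inside] and [flux_ge_outside] respectively. *)
Definition err_near x y := ((`|x - x0| < b) && (`|y - x0| < b))%R%:R *
  ((m%:R * (2 / (b - a))) * level x * enorm (x - y)) `^ p x y.
Definition err_far x y := ((b <= `|x - x0|) && (`|y - x0| < (a + b) / 2))%R%:R *
  (Num.max 0 (u x) `^ (p x y - 1) * level y).
Definition err x y := err_near x y + err_far x y.

(** The part of the energy that is kept: u is above the level at x, below it at y. *)
Definition cut_term x y :=
  level x `^ p x y * cutoff x0 a b x ^+ m * (u y <= k)%R%:R.

Local Notation eta := (cutoff x0 a b).
Let c01 x : 0 <= eta x <= 1 := cutoff01 x0 a b x.
Let c0 x : 0 <= eta x. Proof. by case/andP: (c01 x). Qed.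
Let d0 : 0 < b - a. Proof. by rewrite subr_gt0. Qed.

Lemma level_ge0 x : 0 <= level x. Proof. exact: above_ge0. Qed.
Lemma test_phi_ge0 x : 0 <= test_phi x.
Proof. by rewrite mulr_ge0 ?level_ge0 ?exprn_ge0. Qed.
Lemma err_near_ge0 x y : 0 <= err_near x y. Proof. by rewrite mulr_ge0 ?powR_ge0. Qed.
Lemma err_far_ge0 x y : 0 <= err_far x y.
Proof. by rewrite mulr_ge0 ?mulr_ge0 ?powR_ge0 ?level_ge0. Qed.
Lemma err_ge0 x y : 0 <= err x y.
Proof. by rewrite addr_ge0 ?err_near_ge0 ?err_far_ge0. Qed.
Lemma cut_term_ge0 x y : 0 <= cut_term x y.
Proof. by rewrite !mulr_ge0 ?powR_ge0 ?exprn_ge0. Qed.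

(** The isoperimetric step uses the energy of the pairs that cross the level, so
    these are what is retained on the left. *)
Lemma flux_lower x y :
  cut_term x y <=
  `|u x - u y| `^ (p x y - 2) * (u x - u y) * (test_phi x - test_phi y) +
  (err x y + err y x).
Proof.
(* Both sides of the sharpened claim are symmetric in x and y, which reduces
   the proof to the case u y <= u x. *)
suff main x' y' : u y' <= u x' ->
    cut_term x' y' + cut_term y' x' <=
    `|u x' - u y'| `^ (p x' y' - 2) * (u x' - u y') * (test_phi x' - test_phi y') +
    (err x' y' + err y' x').
  have cx := cut_term_ge0 x y; have cy := cut_term_ge0 y x.
  have [/main h|/ltW/main h] := leP (u y) (u x); first lra.
  rewrite (adm_sym H) distrC.
  rewrite (_ : _ * _ * _ = `|u y - u x| `^ (p y x - 2) * (u y - u x) *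
    (test_phi y - test_phi x)); last ring.
  lra.
move=> {x y}; move: x' y' => x y yx.
have cyx : cut_term y x = 0.
  rewrite /cut_term; have [xk|] := leP (u x) k; last by rewrite mulr0.
  by rewrite /level above_le0 ?powR0 ?mul0r ?gt_eqF// (le_trans yx).
have e1 := err_ge0 x y; have e2 := err_ge0 y x.
rewrite cyx addr0.
have [h|] := boolP ((u y <= k) || (eta y <= eta x)).
  have := @flux_ge_cut R k (u x) (u y) (eta x) (eta y) (p x y) m yx (c01 x) (c01 y)
    (p1 x y) h.
  rewrite -/(level x) -/(level y) -/(test_phi x) -/(test_phi y) -/(cut_term x y); lra.
rewrite negb_or -!ltNge => /andP[ky xy].
have -> : cut_term x y = 0.
  by rewrite /cut_term leNgt ky mulr0.
have yB' : `|y - x0| < (a + b) / 2.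
  rewrite ltNge; apply/negP => /(cutoff0 ab) h; have := c0 x; move: xy; rewrite h; lra.
have yB : `|y - x0| < b by have := d0; lra.
have [xB|xB] := ltP (`|x - x0|) b.
  have := @flux_ge_inside R k (u x) (u y) (eta x) (eta y) (p x y) m yx (c01 x) (c01 y)
    (p1 x y) (pm x y) _ ky xy (cutoff_lip x0 ab x y).
  rewrite -/(level x) -/(level y) -/(test_phi x) -/(test_phi y).
  have := err_far_ge0 x y.
  have -> : err x y = (m%:R * level x * (2 / (b - a) * enorm (x - y))) `^ p x y + err_far x y.
    rewrite /err /err_near xB yB mul1r; congr (_ `^ _ + _); ring.
  lra.
have ex0 : eta x = 0 by apply: (cutoff0 ab); have := d0; lra.
have := @flux_ge_outside R k (u x) (u y) (eta x) (eta y) (p x y) m yx (c01 y)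
    (p1 x y) (pm x y) k0 ex0 ky.
rewrite -/(level x) -/(level y) -/(test_phi x) -/(test_phi y).
have := err_near_ge0 x y.
have -> : err x y = err_near x y + Num.max 0 (u x) `^ (p x y - 1) * level y.
  by rewrite /err /err_far xB yB' mul1r.
lra.
Qed.

Let expr_lip (s1 t1 : R) (q : nat) : 0 <= s1 <= 1 -> 0 <= t1 <= 1 ->
  `|s1 ^+ q - t1 ^+ q| <= q%:R * `|s1 - t1|.
Proof.
move=> /andP[s0 s1'] /andP[t0 t1'].
rewrite subrXX normrM mulrC ler_wpM2r//.
apply: (le_trans (ler_norm_sum _ _ _)).
rewrite -[X in _ <= X%:R](card_ord q) -sumr_const; apply: ler_sum => i _.
rewrite ger0_norm ?mulr_ge0 ?exprn_ge0//.
by rewrite mulr_ile1 ?exprn_ge0 ?exprn_ile1.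
Qed.

(** The test function has finite energy although p (x, y) can be large for x far
    away.  If the height w at y is at most twice the difference of the heights,
    the energy of u dominates; otherwise w y <= 2 w x, and
    w y^p <= 2^p (w x)^(p - 1) w y is a tail term, that is, part of err. *)
Lemma test_phi_diff x y :
  `|test_phi x - test_phi y| `^ p x y <=
  2 `^ P * (`|u x - u y| `^ p x y + (err x y + err y x)).
Proof.
have pP x1 y1 : p x1 y1 <= P := adm_le H x1 y1.
have e1 := err_ge0 x y; have e2 := err_ge0 y x.
have two1 : 0 < 2 `^ P :> R by rewrite powR_gt0.
have far x' y' : b <= `|x' - x0| ->
    `|test_phi x' - test_phi y'| `^ p x' y' <=
    2 `^ P * (`|u x' - u y'| `^ p x' y' + err x' y').
  move=> xB; have xB' : (a + b) / 2 <= `|x' - x0| by have := d0; lra.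
  have e := err_ge0 x' y'.
  rewrite {1}/test_phi (cutoff0 ab xB').
  have m0 : (0 < m)%N by rewrite -(ltr_nat R) (lt_le_trans _ (pm x' y')).
  rewrite expr0n (gtn_eqF m0) mulr0 sub0r normrN ger0_norm ?test_phi_ge0//.
  have [yB'|yB'] := leP ((a + b) / 2) (`|y' - x0|).
    rewrite /test_phi (cutoff0 ab yB') expr0n (gtn_eqF m0) mulr0 powR0 ?gt_eqF//.
    by apply: mulr_ge0; [exact: ltW|rewrite addr_ge0 ?powR_ge0].
  apply: (@le_trans _ _ (level y' `^ p x' y')).
    apply: ler_powR_base; [exact: ltW|exact: test_phi_ge0|].
    by rewrite ler_piMr ?level_ge0// exprn_ile1//; case/andP: (c01 y').
  have [h|h] := leP (level y') (2 * `|level x' - level y'|).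
    apply: (@le_trans _ _ (2 `^ P * (`|u x' - u y'| `^ p x' y'))); last first.
      by rewrite ler_wpM2l ?powR_ge0// lerDl.
    apply: (@le_trans _ _ ((2 * `|u x' - u y'|) `^ p x' y')).
      apply: ler_powR_base; [exact: ltW|exact: level_ge0|].
      by apply: (le_trans h); rewrite ler_wpM2l// above_lip.
    rewrite powRM// ler_wpM2r ?powR_ge0//; apply: ler_powR; [by rewrite ler1n|exact: pP].
  have h' : level y' <= 2 * level x'.
    have := level_ge0 x'; have := ler_norm (level y' - level x'); move: h.
    rewrite distrC; lra.
  apply: (@le_trans _ _ (2 `^ P * (Num.max 0 (u x') `^ (p x' y' - 1) * level y'))); last first.
    rewrite ler_wpM2l ?powR_ge0// -[leLHS]add0r lerD ?powR_ge0//.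
    by rewrite /err /err_far xB yB' mul1r lerDr err_near_ge0.
  rewrite -(@powR_predM _ (level y') (p x' y')) ?level_ge0//.
  rewrite mulrA ler_wpM2r ?level_ge0//.
  have pp1 : 0 <= p x' y' - 1 by rewrite subr_ge0 ltW.
  apply: (@le_trans _ _ ((2 * Num.max 0 (u x')) `^ (p x' y' - 1))).
    apply: ler_powR_base => //; first exact: level_ge0.
    apply: (le_trans h'); rewrite ler_wpM2l//; exact: above_le_pos.
  rewrite powRM ?le_max ?lexx// ler_wpM2r ?powR_ge0//; apply: ler_powR; first by rewrite ler1n.
  have := pP x' y'; lra.
have [xB|xB] := leP b (`|x - x0|).
  apply: (le_trans (far _ _ xB)); rewrite ler_wpM2l ?(ltW two1)//; lra.
have [yB|yB] := leP b (`|y - x0|).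
  rewrite (adm_sym H) distrC [`|u x - _|]distrC.
  apply: (le_trans (far _ _ yB)); rewrite ler_wpM2l ?(ltW two1)//; lra.
apply: (@le_trans _ _ ((`|u x - u y| + m%:R * (2 / (b - a)) * level y * enorm (y - x)) `^ p x y)).
  apply: ler_powR_base; rewrite ?(ltW (p0 _ _))//.
  rewrite (_ : test_phi x - test_phi y = (level x - level y) * eta x ^+ m +
     level y * (eta x ^+ m - eta y ^+ m)); last by rewrite /test_phi; ring.
  apply: (le_trans (ler_normD _ _)); rewrite !normrM lerD//.
    apply: (@le_trans _ _ (`|level x - level y|)); last exact: above_lip.
    rewrite ler_piMr// ger0_norm ?exprn_ge0// exprn_ile1//; by case/andP: (c01 x).
  rewrite ger0_norm ?level_ge0//.
  rewrite (_ : _ * _ * level y * _ = level y * (m%:R * (2 / (b - a) * enorm (y - x)))); last ring.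
  rewrite ler_wpM2l ?level_ge0//; apply: (le_trans (expr_lip _ (c01 x) (c01 y))).
  by rewrite ler_wpM2l// distrC cutoff_lip.
apply: (le_trans (powRD_le (P := P) _ _ _ _)) => //.
- by rewrite !mulr_ge0 ?level_ge0 ?enorm_ge0 ?invr_ge0 ?(ltW d0).
- exact: ltW.
rewrite ler_wpM2l ?(ltW two1)// lerD2l.
have -> : (m%:R * (2 / (b - a)) * level y * enorm (y - x)) `^ p x y = err_near y x.
  by rewrite /err_near xB yB mul1r (adm_sym H y x).
by rewrite -[leLHS]add0r lerD// /err lerDl err_far_ge0.
Qed.

End pointwise.

(** * The Caccioppoli inequality *)

Lemma powR_le_add1 (R : realType) (a p q : R) : 0 <= a -> 0 <= p -> p <= q ->
  a `^ p <= a `^ q + 1.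
Proof.
move=> a0 p0 pq; have [a1|/ltW a1] := leP a 1.
  apply: (@le_trans _ _ 1); last by rewrite lerDr powR_ge0.
  by rewrite [leRHS](_ : 1 = 1 `^ p); [exact: ler_powR_base|rewrite powR1].
by apply: (@le_trans _ _ (a `^ q)); [exact: ler_powR|rewrite lerDl].
Qed.

Section product_projections.
Context (R : realType) (n : nat) d (T : measurableType d).
Local Notation Rn := 'rV[R]_n.

Lemma measurable_comp_fst (f : Rn -> T) : measurable_fun setT f ->
  measurable_fun setT (fun z : Rn * Rn => f z.1).
Proof. by move=> mf; apply: (measurableT_comp mf). Qed.

Lemma measurable_comp_snd (f : Rn -> T) : measurable_fun setT f ->
  measurable_fun setT (fun z : Rn * Rn => f z.2).
Proof. by move=> mf; apply: (measurableT_comp mf). Qed.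

End product_projections.

Section err_integral.
Context (R : realType) (n : nat) (s : R) (p : 'rV[R]_n -> 'rV[R]_n -> R) (P : R).
Hypothesis H : admissible s p P.
Local Notation Rn := 'rV[R]_n.
Local Notation mu := (@lebesgue_rV R n).
Local Notation K := (kernel_denom s p).
Context (u : Rn -> R) (x0 : Rn) (r0 q1 q2 : R).
Hypothesis L : local_data s p u x0 r0 q1 q2.
Context (m : nat).
Hypothesis Pm : P <= m%:R.
Context (T : R).
Hypothesis T0 : 0 <= T.
Hypothesis uT : forall x, `|x - x0| < r0 ->
  (\int[mu]_y (Num.max 0 (u y) `^ (p x y - 1) / (1 + enorm y `^ (n%:R + s * p x y)))%:E <= T%:E)%E.

Let n0 : (0 < n)%N := adm_n H.
Let n1 : 1 <= n%:R :> R. Proof. by rewrite ler1n. Qed.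
Let p1 x y : 1 < p x y := adm_gt1 H x y.
Let p0 x y : 0 < p x y. Proof. exact: lt_trans ltr01 (p1 x y). Qed.
Let P1 : 1 < P. Proof. exact: lt_le_trans (p1 0 0) (adm_le H 0 0). Qed.
Let P0 : 0 < P. Proof. exact: lt_trans ltr01 P1. Qed.
Let m1 : 1 <= m%:R :> R. Proof. exact: le_trans (ltW P1) Pm. Qed.

Lemma measurable_level k : measurable_fun setT (level u k).
Proof.
by apply: measurable_maxr => //; apply: measurable_funB => //; exact: (loc_meas L).
Qed.

Lemma measurable_divK (f : Rn * Rn -> R) : measurable_fun setT f ->
  measurable_fun setT (fun z : Rn * Rn => (f z / K z.1 z.2)).
Proof.
move=> mf; apply: measurable_funM => //; apply: measurable_ge0V.
  by move=> z; exact: kernel_denom_ge0.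
exact: (measurable_kernel_denom H).
Qed.

Lemma measurable_err_near b a k : measurable_fun setT
  (fun z : Rn * Rn => err_near p u x0 a b k m z.1 z.2).
Proof.
apply: measurable_funM.
  apply: measurable_natb; apply: measurable_and.
    by apply: (measurable_comp_fst (f := fun x => `|x - x0| < b)); exact: measurable_in_cube.
  by apply: (measurable_comp_snd (f := fun x => `|x - x0| < b)); exact: measurable_in_cube.
apply: measurable_powR2; last exact: (adm_meas H).
apply: measurable_funM; last exact: measurable_dist.
by apply: measurable_funM => //; apply: measurable_comp_fst; exact: measurable_level.
Qed.

Lemma measurable_err_far b a k : measurable_fun setT
  (fun z : Rn * Rn => err_far p u x0 a b k z.1 z.2).
Proof.
apply: measurable_funM.
  apply: measurable_natb; apply: measurable_and.
    apply: (measurable_comp_fst (f := fun x => b <= `|x - x0|)); apply: measurable_fun_ler => //.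
    apply: (measurableT_comp (measurable_norm_rV (n := n))); exact: measurable_rVB.
  by apply: (measurable_comp_snd (f := fun x => `|x - x0| < (a + b) / 2)); exact: measurable_in_cube.
apply: measurable_funM; last by apply: measurable_comp_snd; exact: measurable_level.
apply: measurable_powR2; last by apply: measurable_funB => //; exact: (adm_meas H).
by apply: (measurable_comp_fst (f := fun x => Num.max 0 (u x))); apply: measurable_maxr => //; exact: (loc_meas L).
Qed.

(** The added 1 bounds all powers between 0 and q2 of the height at once. *)
Definition level_mass b k x : R :=
  ((`|x - x0| < b) && (k < u x))%R%:R * (level u k x `^ q2 + 1).

Lemma level_mass_ge0 b k x : 0 <= level_mass b k x.
Proof. by rewrite mulr_ge0 ?addr_ge0 ?powR_ge0. Qed.

Lemma measurable_level_mass b k : measurable_fun setT (level_mass b k).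
Proof.
apply: measurable_funM.
  apply: measurable_natb; apply: measurable_and; first exact: measurable_in_cube.
  by apply: measurable_fun_ltr => //; exact: (loc_meas L).
apply: measurable_funD => //; apply: measurable_powR2 => //; exact: measurable_level.
Qed.

Let r01 : 2 * r0 <= 1.
Proof.
apply: le_trans (loc_small L); rewrite ler_wpM2r ?(ltW (loc_r0 L))//.
by rewrite ler_peMr.
Qed.

Let q12 : q1 <= q2.
Proof.
have c : `|x0 - x0| < r0 by rewrite subrr normr0 (loc_r0 L).
by have /andP[h1 h2] := loc_osc L c c; exact: le_trans h2.
Qed.

Definition err_scale : R := 2 * (m%:R + n%:R * (2 + `|x0|)).

(** The near part is integrated first in y, using [near_kernel_integral]; the far
    part is integrated first in x, which produces the tail centred at y, so
    that the order of integration has to be exchanged.  The dependence on the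
    width b - a is explicit because the widths tend to 0 in the iteration. *)
Lemma err_integral : exists C : R, 0 <= C /\
  forall a b k, 0 <= k -> a < b -> b <= r0 -> b - a <= 1 ->
  (\int[mu]_x \int[mu]_y (err p u x0 a b k m x y / K x y)%:E <=
  ((err_scale / (b - a)) `^ (n%:R + P) * C)%:E * \int[mu]_x (level_mass b k x)%:E)%E.
Proof.
have [Ck [Ck0 hCk]] := near_kernel_integral H.
have r00 := loc_r0 L; have small := loc_small L.
exists (Ck + 2 * T); split; first by rewrite addr_ge0 ?mulr_ge0.
move=> a b k k0 ab br0 ba1.
have d0 : 0 < b - a by rewrite subr_gt0.
pose G : R := m%:R * (2 / (b - a)).
pose G2 : R := n%:R * (1 + (1 + `|x0|)) / ((b - a) / 2).
pose D := err_scale / (b - a).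
have nx0 : 0 <= `|x0| by [].
have nn0 : 0 <= n%:R * (2 + `|x0|) by rewrite mulr_ge0 ?addr_ge0.
have GD : G <= D.
  rewrite /G /D /err_scale mulrA ler_wpM2r ?invr_ge0 ?(ltW d0)//; lra.
have G2D : G2 <= D.
  rewrite /G2 /D /err_scale invf_div mulrA ler_wpM2r ?invr_ge0 ?(ltW d0)//.
  have := m1; rewrite (_ : 1 + (1 + _) = 2 + `|x0|); last ring; lra.
have G1 : 1 <= G.
  rewrite /G mulrA ler_pdivlMr// mul1r; have := m1; lra.
have D1 : 1 <= D by exact: le_trans GD.
have G20 : 0 <= G2.
  by rewrite divr_ge0 ?(divr_ge0 (ltW d0))// mulr_ge0// addr_ge0// addr_ge0.
have N0 : 0 <= n%:R + P by rewrite addr_ge0// (ltW P0).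
have GN : G `^ P <= D `^ (n%:R + P).
  apply: (@le_trans _ _ (D `^ P)); first by apply: ler_powR_base => //; [exact: ltW|lra].
  by apply: ler_powR => //; rewrite lerDr.
have G2N : G2 `^ (n%:R + P) <= D `^ (n%:R + P) by apply: ler_powR_base.
have mnear : measurable_fun setT (fun z : Rn * Rn => (err_near p u x0 a b k m z.1 z.2 / K z.1 z.2)%:E).
  by apply/measurable_EFinP; apply: measurable_divK; exact: measurable_err_near.
have mfar : measurable_fun setT (fun z : Rn * Rn => (err_far p u x0 a b k z.1 z.2 / K z.1 z.2)%:E).
  by apply/measurable_EFinP; apply: measurable_divK; exact: measurable_err_far.
have near0 x y : (0 <= (err_near p u x0 a b k m x y / K x y)%:E)%E.
  by rewrite lee_fin divr_ge0 ?kernel_denom_ge0 ?err_near_ge0.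
have far0 x y : (0 <= (err_far p u x0 a b k x y / K x y)%:E)%E.
  by rewrite lee_fin divr_ge0 ?kernel_denom_ge0 ?err_far_ge0.
have lm0 x : (0 <= (level_mass b k x)%:E)%E by rewrite lee_fin level_mass_ge0.
have mlm : measurable_fun setT (fun x => (level_mass b k x)%:E).
  by apply/measurable_EFinP; exact: measurable_level_mass.
have -> : (\int[mu]_x \int[mu]_y (err p u x0 a b k m x y / K x y)%:E =
   \int[mu]_x \int[mu]_y (err_near p u x0 a b k m x y / K x y)%:E +
   \int[mu]_x \int[mu]_y (err_far p u x0 a b k x y / K x y)%:E)%E.
  rewrite -ge0_integralD//; last 4 first.
  - by move=> x _; apply: integral_ge0.
  - exact: (measurable_fun_fubini_tonelli_F _ mnear (fun z => near0 z.1 z.2)).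
  - by move=> x _; apply: integral_ge0.
  - exact: (measurable_fun_fubini_tonelli_F _ mfar (fun z => far0 z.1 z.2)).
  apply: eq_integral => x _; rewrite -ge0_integralD//.
  - by apply: eq_integral => y _; rewrite /err mulrDl EFinD.
  - exact: (measurableT_comp mnear (pair1_measurable x)).
  - exact: (measurableT_comp mfar (pair1_measurable x)).
rewrite mulrDr EFinD ge0_muleDl; [|by rewrite lee_fin mulr_ge0 ?powR_ge0|by rewrite lee_fin !mulr_ge0 ?powR_ge0].
have scale C1 C2 : 0 <= C1 -> C1 <= C2 ->
    (\int[mu]_x ((level_mass b k x)%:E * C1%:E) <= C2%:E * \int[mu]_x (level_mass b k x)%:E)%E.
  move=> C10 C12; rewrite ge0_integralZr//.
  rewrite muleC lee_wpmul2r ?lee_fin//; apply: integral_ge0 => x _; exact: lm0.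
apply: leeD.
  apply: le_trans (scale (G `^ P * Ck) _ _ _); last 2 first.
  - by rewrite mulr_ge0 ?powR_ge0.
  - by rewrite ler_wpM2r.
  apply: ge0_le_integral_total => x; first by apply: integral_ge0.
  have mg : measurable_fun setT (fun y : Rn => ((`|y - x| < 1)%R%:R *
      (enorm (x - y))^-1 `^ (n%:R - (1 - s)))%:E).
    apply/measurable_EFinP/measurable_funM.
      by apply: measurable_natb; exact: measurable_in_cube.
    apply: measurable_powR2 => //; apply: measurable_ge0V.
      by move=> y; exact: enorm_ge0.
    exact: (measurableT_comp (measurable_dist (R:=R) (n:=n)) (pair1_measurable x)).
  apply: (@le_trans _ _ (\int[mu]_y ((level_mass b k x * G `^ P)%:E * ((`|y - x| < 1)%R%:R *
      (enorm (x - y))^-1 `^ (n%:R - (1 - s)))%:E))%E); last first.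
    rewrite ge0_integralZl_EFin//; last by rewrite mulr_ge0 ?level_mass_ge0 ?powR_ge0.
    - rewrite EFinM -muleA; apply: lee_wpmul2l => //.
      by rewrite EFinM; apply: lee_wpmul2l; [rewrite lee_fin powR_ge0|exact: hCk].
    - by move=> y _; rewrite lee_fin mulr_ge0 ?powR_ge0.
  apply: ge0_le_integral_total => y; first exact: near0.
  rewrite -EFinM lee_fin /err_near.
  have rhs0 : 0 <= level_mass b k x * G `^ P *
     ((`|y - x| < 1)%R%:R * (enorm (x - y))^-1 `^ (n%:R - (1 - s))).
    by rewrite !mulr_ge0 ?powR_ge0 ?addr_ge0 ?powR_ge0.
  have [/andP[xB yB]|_] := boolP (_ && _); last by rewrite mul0r mul0r.
  rewrite mul1r -/G.
  have [uk|ku] := leP (u x) k.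
    rewrite {1}/level above_le0// mulr0 mul0r powR0 ?mul0r//.
    by rewrite gt_eqF.
  have xr : `|x - x0| < r0 by lra.
  have yr : `|y - x0| < r0 by lra.
  have yx : `|y - x| < 2 * r0.
    rewrite (_ : y - x = (y - x0) - (x - x0)); last by rewrite opprB addrA subrK.
    apply: (le_lt_trans (ler_normB _ _)); lra.
  have /andP[qa qb] := loc_osc L xr yr.
  have e1 : enorm (x - y) <= 1.
    apply: (le_trans (enorm_le_norm _)); rewrite distrC; apply: le_trans small.
    by rewrite mulrAC [2 * r0 * _]mulrC ler_wpM2l// ltW.
  apply: (le_trans (near_kernel_quotient H e1 (level_ge0 u k x) G1)).
  have -> : (`|y - x| < 1)%R by apply: lt_le_trans yx r01.
  rewrite mul1r ler_wpM2r ?powR_ge0// [leRHS]mulrC ler_wpM2l ?powR_ge0//.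
  rewrite /level_mass xB ku mul1r; apply: powR_le_add1 => //; first exact: level_ge0.
  exact: ltW.
rewrite (fubini_tonelli (fun z => (err_far p u x0 a b k z.1 z.2 / K z.1 z.2)%:E))//.
apply: le_trans (scale (2 * G2 `^ (n%:R + P) * T) _ _ _); last 2 first.
- by rewrite !mulr_ge0 ?powR_ge0.
- by rewrite mulrAC mulrC ler_wpM2r ?mulr_ge0.
apply: ge0_le_integral_total => y; first by apply: integral_ge0.
pose tau x := Num.max 0 (u x) `^ (p y x - 1) / (1 + enorm x `^ (n%:R + s * p y x)).
have tau0 x : 0 <= tau x by rewrite divr_ge0 ?powR_ge0 ?addr_ge0 ?powR_ge0.
have mp : measurable_fun setT (p y).
  exact: (measurableT_comp (adm_meas H) (pair1_measurable y)).
have mtau : measurable_fun setT (fun x => (tau x)%:E).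
  apply/measurable_EFinP/measurable_funM.
    apply: measurable_powR2; last exact: measurable_funB.
    by apply: measurable_maxr => //; exact: (loc_meas L).
  apply: measurable_ge0V; first by move=> x; rewrite addr_ge0 ?powR_ge0.
  apply: measurable_funD => //; apply: measurable_powR2; first exact: measurable_enorm.
  by apply: measurable_funD => //; exact: measurable_funM.
have [yB'|yB'] := ltP (`|y - x0|) ((a + b) / 2); last first.
  rewrite (eq_integral (cst 0%E)) ?integral0; last first.
    by move=> x _; rewrite /err_far [in X in X%:R](ltNge _ ((a+b)/2)) yB' andbF !mul0r.
  by rewrite mule_ge0// lee_fin !mulr_ge0 ?powR_ge0.
have yB : `|y - x0| < b by lra.
have yr : `|y - x0| < r0 by lra.
have lmy : level u k y <= level_mass b k y.
  have [uk|ku] := leP (u y) k; first by rewrite {1}/level above_le0// level_mass_ge0.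
  rewrite /level_mass yB ku mul1r -[leLHS]powRr1 ?level_ge0//.
  by apply: powR_le_add1; rewrite ?level_ge0// (le_trans (loc_q1 L)).
apply: (@le_trans _ _ (\int[mu]_x ((level_mass b k y * (2 * G2 `^ (n%:R + P)))%:E *
  (tau x)%:E))%E); last first.
  rewrite ge0_integralZl_EFin//; last 2 first.
  - by move=> x _; rewrite lee_fin.
  - by rewrite !mulr_ge0 ?powR_ge0 ?addr_ge0 ?powR_ge0.
  rewrite EFinM -muleA; apply: lee_wpmul2l => //.
  rewrite [leRHS]EFinM; apply: lee_wpmul2l; first by rewrite lee_fin mulr_ge0 ?powR_ge0.
  exact: uT.
apply: ge0_le_integral_total => x; first exact: far0.
rewrite -EFinM lee_fin /err_far.
have [/andP[xB _]|_] := boolP (_ && _); last first.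
  by rewrite !mul0r !mulr_ge0 ?powR_ge0 ?invr_ge0 ?addr_ge0 ?powR_ge0.
rewrite mul1r (adm_sym H x y) mulrAC.
have yLam : `|y| <= 1 + `|x0|.
  rewrite -[y](subrK x0) (le_trans (ler_normD _ _))// lerD2r; have := r01; lra.
have de : (b - a) / 2 <= enorm (x - y).
  apply: le_trans (norm_le_enorm _).
  rewrite (_ : x - y = (x - x0) - (y - x0)); last by rewrite opprB addrA subrK.
  have := lerB_dist (x - x0) (y - x0); lra.
have dd : 0 < (b - a) / 2 by rewrite divr_gt0.
have dd1 : (b - a) / 2 <= 1 by lra.
have L0 : 0 <= 1 + `|x0| by rewrite addr_ge0.
have h := far_kernel H dd dd1 L0 yLam de.
apply: (@le_trans _ _ (level u k y * (Num.max 0 (u x) `^ (p y x - 1) *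
  (2 * G2 `^ (n%:R + P) / (1 + enorm x `^ (n%:R + s * p y x)))))).
  by rewrite [leLHS]mulrC ler_wpM2l ?level_ge0// ler_wpM2l ?powR_ge0.
rewrite -[leRHS]mulrA; apply: ler_pM => //; first exact: level_ge0.
  by rewrite !mulr_ge0 ?powR_ge0 ?invr_ge0 ?addr_ge0 ?powR_ge0.
by rewrite /tau le_eqVlt; apply/orP; left; apply/eqP; ring.
Qed.

End err_integral.

Section flux_integrable.
Context (R : realType) (n : nat) (s : R) (p : 'rV[R]_n -> 'rV[R]_n -> R) (P : R).
Hypothesis H : admissible s p P.
Local Notation Rn := 'rV[R]_n.
Local Notation mu := (@lebesgue_rV R n).
Local Notation K := (kernel_denom s p).
Local Notation energy v := (fun z : Rn * Rn => `|v z.1 - v z.2| `^ p z.1 z.2 / K z.1 z.2).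

Definition flux (u phi : Rn -> R) (z : Rn * Rn) : R :=
  `|u z.1 - u z.2| `^ (p z.1 z.2 - 2) * (u z.1 - u z.2) * (phi z.1 - phi z.2) / K z.1 z.2.

Lemma measurable_energy (v : Rn -> R) : measurable_fun setT v ->
  measurable_fun setT (energy v).
Proof.
move=> mv; apply: (measurable_divK H); apply: measurable_powR2; last exact: (adm_meas H).
apply: measurableT_comp => //.
by apply: measurable_funB; [exact: measurable_comp_fst|exact: measurable_comp_snd].
Qed.

Lemma energy_ge0 (v : Rn -> R) z : 0 <= energy v z.
Proof. by rewrite divr_ge0 ?powR_ge0// kernel_denom_ge0. Qed.

Lemma measurable_flux (u phi : Rn -> R) : measurable_fun setT u -> measurable_fun setT phi ->
  measurable_fun setT (flux u phi).
Proof.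
move=> mv mphi; apply: (measurable_divK H).
have mB (w : Rn -> R) : measurable_fun setT w -> measurable_fun setT (fun z : Rn * Rn => w z.1 - w z.2 : R).
  by move=> mw; apply: measurable_funB; [exact: measurable_comp_fst|exact: measurable_comp_snd].
apply: measurable_funM; last exact: mB.
apply: measurable_funM; last exact: mB.
apply: measurable_powR2; first by apply: measurableT_comp => //; exact: mB.
by apply: measurable_funB => //; exact: (adm_meas H).
Qed.

(** Young's inequality; in particular the weak form is absolutely convergent on the
    energy space. *)
Lemma abs_flux_le (u phi : Rn -> R) z : `|flux u phi z| <= energy u z + energy phi z.
Proof.
rewrite /flux normrM [X in _ * X]ger0_norm ?invr_ge0 ?kernel_denom_ge0//.
rewrite -mulrDl ler_wpM2r ?invr_ge0 ?kernel_denom_ge0// !normrM.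
rewrite ger0_norm ?powR_ge0//.
apply: le_trans (young_max _ _ (ltW (adm_gt1 H _ _))) => //.
by rewrite ler_wpM2r// abs_flux.
Qed.

Lemma modularE (v : Rn -> R) : measurable_fun setT v ->
  modular s p v = (\int[mu \x mu]_z (energy v z)%:E)%E.
Proof.
move=> mv; apply/esym/(fubini_tonelli1 (EFin \o energy v) (m1 := mu) (m2 := mu)).
  by apply/measurable_EFinP; exact: measurable_energy.
by move=> z; rewrite lee_fin energy_ge0.
Qed.

Lemma flux_integrable (u phi : Rn -> R) :
  measurable_fun setT u -> measurable_fun setT phi ->
  (modular s p u < +oo)%E -> (modular s p phi < +oo)%E ->
  (mu \x mu)%E.-integrable setT (EFin \o flux u phi).
Proof.
move=> mu_ mphi hu hphi; apply/integrableP; split.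
  by apply/measurable_EFinP; exact: measurable_flux.
apply: (@le_lt_trans _ _ (\int[mu \x mu]_z ((energy u z)%:E + (energy phi z)%:E))%E).
  by apply: ge0_le_integral_total => z //=; rewrite -EFinD lee_fin abs_flux_le.
have mE (v : Rn -> R) : measurable_fun setT v -> measurable_fun setT (EFin \o energy v).
  by move=> mv; apply/measurable_EFinP; exact: measurable_energy.
rewrite ge0_integralD//; last 4 first.
- by move=> z _; rewrite lee_fin energy_ge0.
- exact: mE.
- by move=> z _; rewrite lee_fin energy_ge0.
- exact: mE.
rewrite (modularE mu_) in hu; rewrite (modularE mphi) in hphi.
exact: (lte_add_pinfty hu hphi).
Qed.

Lemma weak_formE (u phi : Rn -> R) :
  measurable_fun setT u -> measurable_fun setT phi ->
  (modular s p u < +oo)%E -> (modular s p phi < +oo)%E ->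
  weak_form s p u phi = (\int[mu \x mu]_z (flux u phi z)%:E)%E.
Proof.
by move=> *; rewrite -(integral12_prod_meas1 (flux_integrable _ _ _ _)).
Qed.

End flux_integrable.

Section caccioppoli.
Context (R : realType) (n : nat) (s : R) (p : 'rV[R]_n -> 'rV[R]_n -> R) (P : R).
Hypothesis H : admissible s p P.
Local Notation Rn := 'rV[R]_n.
Local Notation mu := (@lebesgue_rV R n).
Local Notation K := (kernel_denom s p).
Context (u : Rn -> R) (x0 : Rn) (r0 q1 q2 : R).
Hypothesis L : local_data s p u x0 r0 q1 q2.
Context (m : nat).
Hypothesis Pm : P <= m%:R.

Definition local_subsolution := forall phi : Rn -> R,
  measurable_fun setT phi -> (forall x, 0 <= phi x) ->
  (forall x, r0 <= `|x - x0| -> phi x = 0) ->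
  (\int[mu]_x (`|phi x| `^ p x x)%:E < +oo)%E -> (modular s p phi < +oo)%E ->
  (weak_form s p u phi <= 0)%E.

(** Integrate [flux_lower].  Finiteness of the error makes the test function
    admissible by [test_phi_diff], and the two error terms have equal integrals
    by symmetry of the kernel. *)
Lemma caccioppoli (a b k : R) : local_subsolution ->
  0 <= k -> a < b -> b <= r0 ->
  (\int[mu]_x \int[mu]_y (err p u x0 a b k m x y / K x y)%:E < +oo)%E ->
  (\int[mu]_x \int[mu]_y (cut_term p u x0 a b k m x y / K x y)%:E <=
   2%:E * \int[mu]_x \int[mu]_y (err p u x0 a b k m x y / K x y)%:E)%E.
Proof.
move=> W k0 ab br Efin.
have mu_ := loc_meas L.
pose E (z : Rn * Rn) : \bar R := (err p u x0 a b k m z.1 z.2 / K z.1 z.2)%:E.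
pose E' (z : Rn * Rn) : \bar R := E (z.2, z.1).
pose phi := test_phi u x0 a b k m.
have E0 z : (0 <= E z)%E by rewrite lee_fin divr_ge0 ?kernel_denom_ge0 ?err_ge0.
have mE : measurable_fun setT E.
  apply/measurable_EFinP; apply: (measurable_divK H); apply: measurable_funD.
    exact: (measurable_err_near H L).
  exact: (measurable_err_far H L).
have mE' : measurable_fun setT E'.
  apply: (measurableT_comp mE).
  by apply: measurable_fun_pair; [exact: measurable_snd|exact: measurable_fst].
pose I := (\int[mu \x mu]_z E z)%E.
have IE : (\int[mu]_x \int[mu]_y (err p u x0 a b k m x y / K x y)%:E)%E = I.
  by have := fubini_tonelli1 E mE E0 (m1:=mu) (m2:=mu); rewrite /fubini_F -/I => ->.
have IE' : (\int[mu \x mu]_z E' z = I)%E.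
  transitivity (\int[mu]_x \int[mu]_y E (y, x))%E.
    exact: (fubini_tonelli1 E' mE' (fun z => E0 _) (m1:=mu) (m2:=mu)).
  exact/esym/(fubini_tonelli2 E mE E0 (m1:=mu) (m2:=mu)).
have EE z : E z = (err p u x0 a b k m z.1 z.2 / K z.1 z.2)%:E := erefl _.
have EE' z : E' z = (err p u x0 a b k m z.2 z.1 / K z.2 z.1)%:E := erefl _.
have E'0 z : (0 <= E' z)%E := E0 _.
clearbody E E'.
rewrite IE in Efin *.
have I0 : (0 <= I)%E by apply: integral_ge0 => z _.
have mEE' : measurable_fun setT (fun z => E z + E' z)%E := emeasurable_funD mE mE'.
have IEE' : (\int[mu \x mu]_z (E z + E' z) = I + I)%E.
  by rewrite ge0_integralD// IE'.
have mphi : measurable_fun setT phi.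
  apply: measurable_funM; first exact: (measurable_level L).
  by apply: measurable_funX; exact: measurable_cutoff.
have phiu x : phi x <= `|u x|.
  apply: (@le_trans _ _ (level u k x)).
    rewrite ler_piMr ?level_ge0// exprn_ile1//; by case/andP: (cutoff01 x0 a b x).
  apply: (le_trans (above_le_pos _ k0)); by rewrite ge_max normr_ge0 ler_norm.
have p0 x y : 0 <= p x y by apply: ltW; exact: lt_trans ltr01 (adm_gt1 H x y).
have phi0 x : 0 <= phi x by exact: test_phi_ge0.
have phiI : (\int[mu]_x (`|phi x| `^ p x x)%:E < +oo)%E.
  apply: le_lt_trans (loc_int L); apply: ge0_le_integral_total => x.
    by rewrite lee_fin powR_ge0.
  by rewrite lee_fin ler_powR_base// [`|phi x|]ger0_norm.
have modu : (modular s p u < +oo)%E := loc_mod L.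
have modphi : (modular s p phi < +oo)%E.
  pose U (z : Rn * Rn) : \bar R := (`|u z.1 - u z.2| `^ p z.1 z.2 / K z.1 z.2)%:E.
  have U0 z : (0 <= U z)%E by rewrite lee_fin divr_ge0 ?powR_ge0 ?kernel_denom_ge0.
  have mU : measurable_fun setT U by apply/measurable_EFinP; exact: (measurable_energy H).
  have UE : (\int[mu \x mu]_z U z)%E = modular s p u := esym (modularE H mu_).
  have UU z : U z = (`|u z.1 - u z.2| `^ p z.1 z.2 / K z.1 z.2)%:E := erefl _.
  clearbody U.
  rewrite (modularE H mphi).
  apply: (@le_lt_trans _ _ (\int[mu \x mu]_z ((2 `^ P)%:E * (U z + (E z + E' z))))%E).
    apply: ge0_le_integral_total => z.
      by rewrite lee_fin divr_ge0 ?powR_ge0 ?kernel_denom_ge0.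
    rewrite UU EE EE' /= (kernel_denom_sym H z.2) -!EFinD -EFinM lee_fin -!mulrDl mulrA.
    rewrite ler_wpM2r ?invr_ge0 ?kernel_denom_ge0//.
    exact: (test_phi_diff H).
  rewrite ge0_integralZl_EFin ?powR_ge0//; last 2 first.
  - by move=> z _; rewrite adde_ge0// adde_ge0.
  - exact: emeasurable_funD.
  rewrite ge0_integralD//; last by move=> z _; exact: adde_ge0.
  rewrite UE IEE'; apply: lte_mul_pinfty; rewrite ?lee_fin ?powR_ge0//.
  by apply: lte_add_pinfty => //; exact: lte_add_pinfty.
have WJ : (\int[mu \x mu]_z (flux s p u phi z)%:E <= 0)%E.
  rewrite -(weak_formE H)//; apply: W => // x xr.
  have m0 : (0 < m)%N.
    by rewrite -(ltr_nat R) (lt_le_trans _ (le_trans (adm_le H 0 0) Pm))// (lt_trans ltr01)// (adm_gt1 H).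
  rewrite /phi /test_phi (cutoff0 ab) ?expr0n ?(gtn_eqF m0) ?mulr0//.
  by apply: le_trans xr; apply: le_trans br; rewrite ler_pdivrMr//; lra.
have IJ := flux_integrable H mu_ mphi modu modphi.
have IEi : (mu \x mu)%E.-integrable setT (fun z => E z + E' z)%E.
  apply/integrableP; split => //.
  rewrite (eq_integral (fun z => E z + E' z)%E); last first.
    by move=> z _; rewrite gee0_abs// adde_ge0.
  by rewrite IEE' lte_add_pinfty.
have mcut : measurable_fun setT (fun z : Rn * Rn =>
    (cut_term p u x0 a b k m z.1 z.2 / K z.1 z.2)%:E).
  apply/measurable_EFinP; apply: (measurable_divK H).
  apply: measurable_funM; last first.
    apply: measurable_natb; apply: (measurable_comp_snd (f := fun y => (u y <= k)%R)).
    exact: measurable_fun_ler.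
  apply: measurable_funM.
    by apply: measurable_powR2; [apply: measurable_comp_fst; exact: (measurable_level L)|exact: (adm_meas H)].
  apply: measurable_funX; apply: measurable_comp_fst; exact: measurable_cutoff.
have cut0 z : (0 <= (cut_term p u x0 a b k m z.1 z.2 / K z.1 z.2)%:E)%E.
  by rewrite lee_fin divr_ge0 ?cut_term_ge0 ?kernel_denom_ge0.
rewrite -(fubini_tonelli1 (fun z => (cut_term p u x0 a b k m z.1 z.2 / K z.1 z.2)%:E))//.
apply: (@le_trans _ _ (\int[mu \x mu]_z ((flux s p u phi z)%:E + (E z + E' z)))%E).
  apply: ge0_le_integral_total => z //.
  rewrite EE EE' /flux/= (kernel_denom_sym H z.2) -!EFinD lee_fin -!mulrDl.
  rewrite ler_wpM2r ?invr_ge0 ?kernel_denom_ge0//.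
  exact: (flux_lower H).
rewrite integralD// IEE'.
rewrite (_ : 2%:E * I = 0 + (I + I))%E; last by rewrite add0e mule_natl.
exact: leeD2r.
Qed.

End caccioppoli.

(** * The De Giorgi iteration *)

Section de_giorgi.
Context (R : realType) (n : nat) (s : R) (p : 'rV[R]_n -> 'rV[R]_n -> R) (P : R).
Hypothesis H : admissible s p P.
Local Notation Rn := 'rV[R]_n.
Local Notation mu := (@lebesgue_rV R n).
Local Notation K := (kernel_denom s p).
Context (u : Rn -> R) (x0 : Rn) (r0 q1 q2 : R).
Hypothesis L : local_data s p u x0 r0 q1 q2.
Context (T : R).
Hypothesis T0 : 0 <= T.
Hypothesis uT : forall x, `|x - x0| < r0 ->
  (\int[mu]_y (Num.max 0 (u y) `^ (p x y - 1) / (1 + enorm y `^ (n%:R + s * p x y)))%:E <= T%:E)%E.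
Hypothesis W : local_subsolution s p u x0 r0.
Context (q M : R).
Hypothesis M0 : 0 <= M.
Hypothesis uM :
  (\int[mu]_x ((`|x - x0| < r0 / 2)%R%:R * (Num.max 0 (u x)) `^ q)%:E <= M%:E)%E.
Hypothesis q2q : q2 < q.
Hypothesis gap : n%:R * (q2 - q1) <= s / 2 * (q - q2).

Let n0 : (0 < n)%N := adm_n H.
Let nR : 0 < n%:R :> R. Proof. by rewrite ltr0n. Qed.
Let n1 : 1 <= n%:R :> R. Proof. by rewrite ler1n. Qed.
Let s0 : 0 < s := adm_s0 H.
Let P1 : 1 < P. Proof. exact: lt_le_trans (adm_gt1 H 0 0) (adm_le H 0 0). Qed.
Let P0 : 0 < P. Proof. exact: lt_trans ltr01 P1. Qed.
Let r00 : 0 < r0 := loc_r0 L.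
Let q11 : 1 <= q1 := loc_q1 L.
Let q10 : 0 < q1. Proof. exact: lt_le_trans ltr01 q11. Qed.
Let small : 2 * n%:R * r0 <= 1 := loc_small L.
Let q12 : q1 <= q2.
Proof.
have c : `|x0 - x0| < r0 by rewrite subrr normr0.
by have /andP[h1 h2] := loc_osc L c c; exact: le_trans h2.
Qed.

Let r01 : 2 * r0 <= 1.
Proof.
apply: le_trans small; rewrite ler_wpM2r ?(ltW r00)//.
by rewrite ler_peMr.
Qed.

Definition excess b k : \bar R :=
  (\int[mu]_x ((`|x - x0| < b)%R%:R * level u k x `^ q1)%:E)%E.

Let dens0 b k x : 0 <= (`|x - x0| < b)%R%:R * level u k x `^ q1.
Proof. by rewrite mulr_ge0 ?powR_ge0. Qed.

Let measurable_dens b k e :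
  measurable_fun setT (fun x : Rn => ((`|x - x0| < b)%R%:R * level u k x `^ e)%:E).
Proof.
apply/measurable_EFinP; apply: measurable_funM.
  by apply: measurable_natb; exact: measurable_in_cube.
by apply: measurable_powR2 => //; exact: (measurable_level L).
Qed.

Lemma level_anti k k' x : k <= k' -> level u k' x <= level u k x.
Proof.
by move=> kk; rewrite /level /above ge_max !le_max lexx/=; apply/orP; right; lra.
Qed.

Lemma excess_le b b' k k' : b' <= b -> k <= k' -> (excess b' k' <= excess b k)%E.
Proof.
move=> bb kk; apply: ge0_le_integral_total => x; first by rewrite lee_fin dens0.
rewrite lee_fin; have [xb|_] := ltP (`|x - x0|) b'; last by rewrite mul0r dens0.
rewrite (lt_le_trans xb bb) !mul1r; apply: ler_powR_base; [exact: ltW|exact: level_ge0|].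
exact: level_anti.
Qed.

Lemma excess_chebyshev b k tau : 0 < tau ->
  ((tau `^ q1)%:E * mu [set x | ((`|x - x0| < b) && (k + tau < u x))%R] <= excess b k)%E.
Proof.
move=> t0; apply: chebyshev_bset; rewrite ?powR_ge0//.
- apply: measurable_and; first exact: measurable_in_cube.
  by apply: measurable_fun_ltr => //; exact: (loc_meas L).
- by move=> x; rewrite lee_fin dens0.
move=> x /andP[xb ku]; rewrite lee_fin xb mul1r.
apply: ler_powR_base; [exact: ltW|exact: ltW|].
by rewrite /level above_ge; lra.
Qed.

Lemma level_set_small b k tau rho : 0 < tau -> tau <= 1 -> 0 <= rho ->
  (excess b k <= (tau `^ P * rho ^+ n)%:E)%E ->
  (mu [set x | ((`|x - x0| < b) && (k + tau < u x))%R] <= (rho ^+ n)%:E)%E.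
Proof.
move=> t0 t1 h0 Y.
have tq0 : 0 < tau `^ q1 by exact: powR_gt0.
rewrite -(@lee_pmul2l _ (tau `^ q1)%:E)//.
apply: (le_trans (excess_chebyshev _ _ t0)).
apply: (le_trans Y); rewrite -EFinM lee_fin ler_wpM2r ?exprn_ge0//.
apply: ger_powR; first by rewrite t0.
have c : `|x0 - x0| < r0 by rewrite subrr normr0.
by have /andP[hh _] := loc_osc L c c; exact: le_trans hh (adm_le H _ _).
Qed.

(** Compares the power e = p x y of the height with q1.  The height is at least tau
    because it is measured from a level lower by tau than the one of interest. *)
Lemma power_gap v tau e : 0 < tau -> tau <= 1 -> tau <= v -> q1 <= e -> e <= P ->
  tau `^ P * v `^ q1 <= v `^ e.
Proof.
move=> t0 t1 tv qe eP; have v0 : 0 < v by lra.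
rewrite (_ : v `^ e = v `^ (e - q1) * v `^ q1); last first.
  by rewrite -powRD ?(gt_eqF v0) ?implybT// subrK.
rewrite ler_wpM2r ?powR_ge0//; have [v1|/ltW v1] := leP v 1.
  apply: (@le_trans _ _ (v `^ P)); first by apply: ler_powR_base => //; exact: ltW.
  by apply: ger_powR; [rewrite v0|have := q10; lra].
apply: (@le_trans _ _ 1).
  rewrite [leRHS](_ : 1 = 1 `^ P); last by rewrite powR1.
  by apply: ler_powR_base => //; exact: ltW.
rewrite -[leLHS](powRr0 v); apply: ler_powR => //; lra.
Qed.

(** The mismatch of exponents.  For w = (u - k)_+ one has
    w^q2 <= Kc^(q2 - q1) w^q1 where w <= Kc, and w^q2 <= Kc^(q2 - q) w^q elsewhere.
    The choice Kc = rho^(- n / (q - q2)) turns the second term into M rho^n, and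
    the hypothesis gap makes the first factor at most rho^(- s / 2). *)
Lemma level_mass_le b k tau rho : b <= r0 / 2 -> 0 <= k -> 0 < tau -> tau <= 1 ->
  0 < rho -> rho <= 1 -> (excess b k <= (tau `^ P * rho ^+ n)%:E)%E ->
  (\int[mu]_x (level_mass u x0 q2 b (k + tau) x)%:E <=
   ((2 + M) * rho `^ (n%:R - s / 2))%:E)%E.
Proof.
move=> br k0 t0 t1 h0 h1 Y.
have rn : rho ^+ n = rho `^ n%:R by rewrite powR_mulrn// ltW.
pose al := n%:R / (q - q2).
have qq0 : 0 < q - q2 by rewrite subr_gt0.
have mb : measurable_fun setT (fun x : Rn => (`|x - x0| < b) && (k + tau < u x)).
  apply: measurable_and; first exact: measurable_in_cube.
  by apply: measurable_fun_ltr => //; exact: (loc_meas L).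
pose Kc := rho `^ (- al).
have Kc0 : 0 < Kc by exact: powR_gt0.
have split w : 0 <= w -> w `^ q2 <= Kc `^ (q2 - q1) * w `^ q1 + Kc `^ (q2 - q) * w `^ q.
  move=> w0; have [->|wn] := eqVneq w 0.
    rewrite powR0 ?addr_ge0 ?mulr_ge0 ?powR_ge0//; by rewrite gt_eqF// (lt_le_trans q10).
  have wp : 0 < w by rewrite lt_neqAle eq_sym wn.
  have [wK|/ltW Kw] := leP w Kc.
    apply: (@le_trans _ _ (Kc `^ (q2 - q1) * w `^ q1)); last by rewrite lerDl mulr_ge0 ?powR_ge0.
    rewrite (_ : w `^ q2 = w `^ (q2 - q1) * w `^ q1); last by rewrite -powRD ?wn ?implybT// subrK.
    by rewrite ler_wpM2r ?powR_ge0//; apply: ler_powR_base; rewrite ?subr_ge0.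
  apply: (@le_trans _ _ (Kc `^ (q2 - q) * w `^ q)); last by rewrite lerDr mulr_ge0 ?powR_ge0.
  rewrite (_ : w `^ q2 = w `^ (q2 - q) * w `^ q); last by rewrite -powRD ?wn ?implybT// subrK.
  rewrite ler_wpM2r ?powR_ge0// -opprB !powRN lef_pV2 ?posrE ?powR_gt0//.
  by apply: ler_powR_base => //; exact: ltW.
pose h (x : Rn) : \bar R := (((`|x - x0| < b) && (k + tau < u x))%R%:R)%:E.
pose f1 (x : Rn) : \bar R := ((`|x - x0| < b)%R%:R * level u k x `^ q1)%:E.
pose f2 (x : Rn) : \bar R := ((`|x - x0| < r0 / 2)%R%:R * (Num.max 0 (u x)) `^ q)%:E.
have h_0 x : (0 <= h x)%E by rewrite lee_fin.
have f1_0 x : (0 <= f1 x)%E by rewrite lee_fin dens0.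
have f2_0 x : (0 <= f2 x)%E by rewrite lee_fin mulr_ge0 ?powR_ge0.
have mh : measurable_fun setT h by apply/measurable_EFinP/measurable_natb.
have mf1 : measurable_fun setT f1 by exact: measurable_dens.
have mf2 : measurable_fun setT f2.
  apply/measurable_EFinP; apply: measurable_funM.
    by apply: measurable_natb; exact: measurable_in_cube.
  apply: measurable_powR2 => //; apply: measurable_maxr => //; exact: (loc_meas L).
have mZ (c : R) f : measurable_fun setT f -> measurable_fun setT (fun x : Rn => c%:E * f x)%E.
  exact: measurable_funeM.
apply: (@le_trans _ _ (\int[mu]_x (((Kc `^ (q2 - q1))%:E * f1 x + (Kc `^ (q2 - q))%:E * f2 x) + h x))%E).
  apply: ge0_le_integral_total => x; first by rewrite lee_fin level_mass_ge0.
  rewrite /f1 /f2 /h -!EFinM -!EFinD lee_fin /level_mass.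
  have c1 := powR_ge0 Kc (q2 - q1); have c2 := powR_ge0 Kc (q2 - q).
  have [/andP[xb ku]|_] := boolP (_ && _); last first.
    by rewrite mul0r addr0 addr_ge0// mulr_ge0// mulr_ge0 ?powR_ge0.
  rewrite xb (lt_le_trans xb br) !mul1r lerD2r.
  apply: (@le_trans _ _ (level u k x `^ q2)).
    apply: ler_powR_base; [by rewrite (le_trans (ltW q10))|exact: level_ge0|].
    by apply: level_anti; lra.
  apply: (le_trans (split _ (level_ge0 u k x))); rewrite lerD2l ler_wpM2l//.
  apply: ler_powR_base; [have := q12; have := q10; have := q2q; lra|exact: level_ge0|].
  exact: above_le_pos.
rewrite ge0_integralD//; last 2 first.
- by move=> x _; rewrite adde_ge0// mule_ge0// lee_fin powR_ge0.
- by apply: emeasurable_funD; exact: mZ.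
rewrite ge0_integralD//; last 4 first.
- by move=> x _; rewrite mule_ge0// lee_fin powR_ge0.
- exact: mZ.
- by move=> x _; rewrite mule_ge0// lee_fin powR_ge0.
- exact: mZ.
rewrite !ge0_integralZl_EFin ?powR_ge0//.
have rs : rho `^ n%:R <= rho `^ (n%:R - s / 2).
  by apply: ger_powR; [rewrite h0|have := s0; lra].
have tP : tau `^ P <= 1.
  rewrite [leRHS](_ : 1 = 1 `^ P); last by rewrite powR1.
  by apply: ler_powR_base => //; exact: ltW.
apply: (@le_trans _ _ ((rho `^ (n%:R - s / 2))%:E + (rho `^ (n%:R - s / 2) * M)%:E +
   (rho `^ (n%:R - s / 2))%:E)%E); last first.
  by rewrite -!EFinD lee_fin; lra.
apply: leeD; first apply: leeD.
- apply: (@le_trans _ _ ((Kc `^ (q2 - q1))%:E * (rho `^ n%:R)%:E)%E).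
    apply: lee_wpmul2l; first by rewrite lee_fin powR_ge0.
    apply: (le_trans Y); rewrite lee_fin rn ler_piMl ?powR_ge0//.
  rewrite -EFinM lee_fin /Kc -powRrM -powRD ?(gt_eqF h0) ?implybT//.
  apply: ger_powR; first by rewrite h0.
  rewrite mulNr [leRHS]addrC lerD2l lerN2 /al mulrAC ler_pdivrMr//.
- rewrite EFinM; apply: lee_pmul; rewrite ?lee_fin ?powR_ge0//.
    by apply: integral_ge0.
  rewrite /Kc -powRrM; apply: le_trans rs; apply: ger_powR; first by rewrite h0.
  by rewrite /al mulNr -mulrN opprB divfK// gt_eqF.
- rewrite integral_natb//; apply: (le_trans (level_set_small t0 t1 (ltW h0) Y)).
  by rewrite lee_fin rn.
Qed.

(** One step of the iteration.  The lower bound of the cut energy, with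
    A = {u > k + tau} and |A| <= rho^n, is compared with the Caccioppoli
    inequality at level k + tau and [level_mass_le].  The hypothesis bounds the
    excess by rho^n up to tau^P, the conclusion by rho^(n + s / 2) up to
    constants: this is the gain. *)
Lemma one_step : exists C : R, 0 < C /\ forall a b k tau rho,
  0 <= a -> a < b -> b <= r0 / 2 -> 0 <= k -> 0 < tau -> tau <= 1 ->
  0 < rho -> rho <= b - a -> rho <= r0 ->
  (excess b k <= (tau `^ P * rho ^+ n)%:E)%E ->
  (excess a (k + tau + tau) <=
    (C * tau `^ (- P) * (b - a) `^ (- (n%:R + P)) * rho `^ (n%:R + s / 2))%:E)%E.
Proof.
have [m Pm] : exists m : nat, P <= m%:R.
  exists (Num.truncn P).+1; apply: ltW; exact: truncnS_gt.
have [C1 [C10 hC1]] := err_integral H L Pm T0 uT.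
have c0 := cut_const_gt0 H.
pose D := err_scale x0 m.
have D0 : 0 <= D by rewrite mulr_ge0 ?addr_ge0 ?mulr_ge0 ?addr_ge0.
pose C := (cut_const n s P)^-1 * 2 * D `^ (n%:R + P) * C1 * (2 + M).
have C0 : 0 <= C.
  by rewrite /C !mulr_ge0 ?powR_ge0 ?invr_ge0 ?(ltW c0)// addr_ge0.
exists (C + 1); split; first by rewrite ltr_wpDl.
move=> a b k tau rho a0 ab br k0 t0 t1 h0 hab hr Y.
have nr : 2 * n%:R * rho <= 1.
  by apply: le_trans small; rewrite ler_wpM2l ?mulr_ge0.
have h1 : rho <= 1.
  apply: le_trans nr; rewrite ler_peMl ?(ltW h0)//.
  have := n1; lra.
have d0 : 0 < b - a by rewrite subr_gt0.
have br0 : b <= r0 by have := r00; lra.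
have LM := level_mass_le br k0 t0 t1 h0 h1 Y.
have k'0 : 0 <= k + tau by lra.
pose E := (\int[mu]_x \int[mu]_y (err p u x0 a b (k + tau) m x y / K x y)%:E)%E.
pose B := (D / (b - a)) `^ (n%:R + P) * C1.
have B0 : 0 <= B by rewrite mulr_ge0 ?powR_ge0.
have EB : (E <= (B * ((2 + M) * rho `^ (n%:R - s / 2)))%:E)%E.
  have ba1 : b - a <= 1 by have := r01; lra.
  apply: (le_trans (hC1 a b _ k'0 ab br0 ba1)).
  by rewrite [leRHS]EFinM; apply: lee_wpmul2l.
have cacc := caccioppoli H L Pm W k'0 ab br0 (le_lt_trans EB (ltry _)).
rewrite -/E in cacc.
pose c := cut_const n s P * rho `^ (- s) * tau `^ P.
have cp : 0 < c by rewrite !mulr_gt0 ?powR_gt0.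
have small_set := level_set_small t0 t1 (ltW h0) Y.
have lower : (c%:E * excess a (k + tau + tau) <=
    \int[mu]_x \int[mu]_y (cut_term p u x0 a b (k + tau) m x y / K x y)%:E)%E.
  rewrite /excess -ge0_integralZl_EFin; [|by []|
    by move=> x _; rewrite lee_fin dens0|exact: measurable_dens|exact: ltW].
  apply: ge0_le_integral_total => x.
    by apply: mule_ge0; rewrite lee_fin ?dens0// ltW.
  have in0 : (0 <= \int[mu]_y (cut_term p u x0 a b (k + tau) m x y / K x y)%:E)%E.
    by apply: integral_ge0 => y _; rewrite lee_fin divr_ge0 ?cut_term_ge0 ?kernel_denom_ge0.
  have [xa|_] := ltP (`|x - x0|) a; last by rewrite mul0r mule0.
  have [uk|ku] := leP (u x) (k + tau + tau).
    by rewrite /level above_le0// powR0 ?gt_eqF// mulr0 mule0.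
  rewrite mul1r -EFinM.
  have yQ y : `|y - x| < rho -> `|y - x0| < b.
    move=> yx; rewrite (_ : y - x0 = (y - x) + (x - x0)); last by rewrite addrA subrK.
    by apply: (le_lt_trans (ler_normD _ _)); lra.
  have xb : `|x - x0| < b by lra.
  pose A y := (`|y - x0| < b) && (k + tau < u y).
  have mA : measurable_fun setT A.
    apply: measurable_and; first exact: measurable_in_cube.
    by apply: measurable_fun_ltr => //; exact: (loc_meas L).
  pose F := tau `^ P * level u (k + tau + tau) x `^ q1.
  have F0 : 0 <= F by rewrite mulr_ge0 ?powR_ge0.
  apply: (@le_trans _ _ (F * (cut_const n s P * rho `^ (- (s * q1))))%:E).
    rewrite lee_fin /c (_ : _ * _ * _ * _ = F * (cut_const n s P * rho `^ (- s)));
      last by rewrite /F; ring.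
    rewrite ler_wpM2l// ler_wpM2l ?(ltW c0)//; apply: ger_powR; first by rewrite h0.
    by rewrite lerN2 ler_peMr// ltW.
  apply: (cut_energy_lower H (A := A) (rho := rho) h0 _ mA _ _ (ltW q10) _ F0).
  - by apply: le_trans nr; rewrite -mulrA ler_peMl ?mulr_ge0 ?(ltW h0)// ler1n.
  - apply: (le_trans small_set); rewrite lee_fin exprMn mulrAC.
    have h2 : 2 <= 2 ^+ n :> R by apply: ler_eXnr => //; rewrite ler1n.
    rewrite ler_peMl ?exprn_ge0 ?(ltW h0)//; lra.
  - by rewrite /A xb/=; lra.
  - move=> y yx; have yb := yQ _ yx.
    have xr : `|x - x0| < r0 by lra.
    have yr : `|y - x0| < r0 by lra.
    by have /andP[] := loc_osc L xr yr.
  - by move=> y; exact: cut_term_ge0.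
  - move=> y nAy yx; have yb := yQ _ yx.
    have xr : `|x - x0| < r0 by lra.
    have yr : `|y - x0| < r0 by lra.
    have /andP[qa _] := loc_osc L xr yr.
    move: nAy; rewrite /A yb/= -leNgt => uy.
    rewrite /cut_term uy mulr1 (cutoff1 ab (ltW xa)) expr1n mulr1 /F.
    apply: (@le_trans _ _ (tau `^ P * level u (k + tau) x `^ q1)).
      rewrite ler_wpM2l ?powR_ge0//; apply: ler_powR_base; [exact: ltW|exact: level_ge0|].
      by apply: level_anti; lra.
    apply: power_gap => //; last exact: (adm_le H).
    by rewrite /level above_ge; lra.
have two0 : (0 <= 2%:E :> \bar R)%E by rewrite lee_fin.
have h := le_trans lower (le_trans cacc (lee_wpmul2l two0 EB)).
have {}h : (excess a (k + tau + tau) <=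
   (c^-1 * (2 * (B * ((2 + M) * rho `^ (n%:R - s / 2)))))%:E)%E.
  by rewrite EFinM lee_pdivlMl// [leRHS]EFinM.
apply: (le_trans h); rewrite lee_fin.
have d_0 := ltW d0.
rewrite (_ : c^-1 * _ = C * tau `^ (- P) * (b - a) `^ (- (n%:R + P)) * rho `^ (n%:R + s / 2)).
  by rewrite !ler_wpM2r ?powR_ge0// lerDl.
rewrite /c /B /C powRM ?invr_ge0// -[(b - a)^-1]powR_inv1// -powRrM mulN1r.
rewrite [(_ * _ * _)^-1]invfM [(cut_const _ _ _ * _)^-1]invfM -!powRN opprK.
rewrite (_ : rho `^ (n%:R + s / 2) = rho `^ s * rho `^ (n%:R - s / 2)); first ring.
by rewrite -powRD ?(gt_eqF h0) ?implybT//; congr (_ `^ _); field.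
Qed.

End de_giorgi.

Section iteration.
Context (R : realType) (n : nat) (s : R) (p : 'rV[R]_n -> 'rV[R]_n -> R) (P : R).
Hypothesis H : admissible s p P.
Local Notation Rn := 'rV[R]_n.
Local Notation mu := (@lebesgue_rV R n).
Local Notation K := (kernel_denom s p).
Context (u : Rn -> R) (x0 : Rn) (r0 q1 q2 : R).
Hypothesis L : local_data s p u x0 r0 q1 q2.
Context (T : R).
Hypothesis T0 : 0 <= T.
Hypothesis uT : forall x, `|x - x0| < r0 ->
  (\int[mu]_y (Num.max 0 (u y) `^ (p x y - 1) / (1 + enorm y `^ (n%:R + s * p x y)))%:E <= T%:E)%E.
Hypothesis W : local_subsolution s p u x0 r0.
Context (q M : R).
Hypothesis M0 : 0 <= M.
Hypothesis uM :
  (\int[mu]_x ((`|x - x0| < r0 / 2)%R%:R * (Num.max 0 (u x)) `^ q)%:E <= M%:E)%E.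
Hypothesis q2q : q2 < q.
Hypothesis gap : n%:R * (q2 - q1) <= s / 2 * (q - q2).


Let nR : 0 < n%:R :> R. Proof. by rewrite ltr0n (adm_n H). Qed.
Let s0 : 0 < s := adm_s0 H.
Let P1 : 1 < P. Proof. exact: lt_le_trans (adm_gt1 H 0 0) (adm_le H 0 0). Qed.
Let P0 : 0 < P. Proof. exact: lt_trans ltr01 P1. Qed.
Let r00 : 0 < r0 := loc_r0 L.
Let q11 : 1 <= q1 := loc_q1 L.
Let q10 : 0 < q1. Proof. exact: lt_le_trans ltr01 q11. Qed.
Let q12 : q1 <= q2.
Proof.
have c : `|x0 - x0| < r0 by rewrite subrr normr0.
by have /andP[h1 h2] := loc_osc L c c; exact: le_trans h2.
Qed.
Local Notation Y := (excess u x0 q1).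

(** This is where integrability to a power q > q1 starts the iteration:
    (u - k)_+^q1 <= k^(q1 - q) u_+^q. *)
Lemma excess_small (y : R) : 0 < y -> exists k, 0 <= k /\ (Y (r0 / 2)%R k <= y%:E)%E.
Proof.
move=> y0.
have qq : 0 < q - q1 by have := q12; have := q2q; lra.
pose c := M / y + 1.
have c1 : 1 <= c by rewrite lerDr divr_ge0// ltW.
pose k := c `^ (q - q1)^-1.
have k0 : 0 < k by rewrite powR_gt0//; lra.
have kM : k `^ (q1 - q) * M <= y.
  rewrite -opprB powRN /k -powRrM mulVf ?gt_eqF// powRr1; last lra.
  rewrite ler_pdivrMl; last lra.
  by rewrite /c mulrDl mul1r divfK ?gt_eqF// lerDl ltW.
clearbody k.
exists k; split; first exact: ltW.
apply: (@le_trans _ _ (k `^ (q1 - q) * M)%:E); last by rewrite lee_fin.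
apply: (@le_trans _ _ (\int[mu]_x ((k `^ (q1 - q))%:E *
   ((`|x - x0| < r0 / 2)%R%:R * (Num.max 0 (u x)) `^ q)%:E))%E).
  apply: ge0_le_integral_total => x; first by rewrite lee_fin mulr_ge0 ?powR_ge0.
  rewrite -EFinM lee_fin mulrCA ler_wpM2l//.
  have [uk|ku] := leP (u x) k.
    by rewrite /level above_le0// powR0 ?gt_eqF// mulr_ge0 ?powR_ge0.
  have u0 : 0 < u x by lra.
  rewrite (max_idPr (ltW u0)).
  apply: (@le_trans _ _ (u x `^ q1)).
    by apply: ler_powR_base; [exact: ltW|exact: level_ge0|rewrite /level above_ge; lra].
  rewrite (_ : u x `^ q1 = u x `^ (q1 - q) * u x `^ q); last first.
    by rewrite -powRD ?(gt_eqF u0) ?implybT// subrK.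
  rewrite ler_wpM2r ?powR_ge0// -opprB !powRN lef_pV2 ?posrE ?powR_gt0//.
  by apply: ler_powR_base; rewrite ?(ltW qq) ?(ltW k0) ?(ltW ku).
rewrite ge0_integralZl_EFin ?powR_ge0//; last 2 first.
- by move=> x _; rewrite lee_fin mulr_ge0 ?powR_ge0.
- apply/measurable_EFinP; apply: measurable_funM.
    by apply: measurable_natb; exact: measurable_in_cube.
  apply: measurable_powR2 => //; apply: measurable_maxr => //; exact: (loc_meas L).
by rewrite EFinM; apply: lee_wpmul2l; rewrite ?lee_fin ?powR_ge0.
Qed.

(** Radii b_j decrease from r0 / 2 to r0 / 4, levels k_j increase from k0 to k0 + 1,
    both with steps proportional to z_j = 2^(-j), and rho_j = kap gam^j.  The
    invariant is excess (b_j) (k_j) <= tau_j^P rho_j^n.  The ratio gam is chosen so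
    that the gain gam^(j s / 2) cancels the losses z_j^(- (2 P + N)) exactly, and
    kap so small that the remaining constants are absorbed. *)
Lemma local_upper_bound : exists B : R,
  mu [set x | ((`|x - x0| < r0 / 4) && (B < u x))%R] = 0%E.
Proof.
have [C [C0 step]] := one_step H L T0 uT W M0 uM q2q gap.
have r8 : 0 < r0 / 8 by rewrite divr_gt0.
pose N := n%:R + P.
have N0 : 0 < N by rewrite addr_gt0.
pose A := C * 2 `^ P * 4 `^ (2 * P) * (r0 / 8) `^ (- N).
have A0 : 0 < A by rewrite !mulr_gt0 ?powR_gt0.
pose gam : R := 2 `^ (- (2 * (2 * P + N) / s)).
have gam0 : 0 < gam by exact: powR_gt0.
have gam2 : gam <= 2^-1.
  rewrite /gam powRN lef_pV2 ?posrE ?powR_gt0//.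
  rewrite -[leLHS]powRr1//; apply: ler_powR; first by rewrite ler1n.
  rewrite ler_pdivlMr// mul1r; have := adm_s1 H; have := P1; have := N0; lra.
pose kap := Num.min (r0 / 8) ((gam ^+ n / A) `^ (2 / s)).
have kap0 : 0 < kap by rewrite lt_min r8 powR_gt0// divr_gt0// exprn_gt0.
have kapr : kap <= r0 / 8 by rewrite ge_min lexx.
have kapA : A * kap `^ (s / 2) <= gam ^+ n.
  have g0 : 0 <= gam ^+ n / A by rewrite divr_ge0 ?exprn_ge0// ltW.
  rewrite mulrC -ler_pdivlMr//.
  apply: (@le_trans _ _ (((gam ^+ n / A) `^ (2 / s)) `^ (s / 2))).
    apply: ler_powR_base; [by rewrite divr_ge0// ltW|exact: ltW|by rewrite ge_min lexx orbT].
  rewrite -powRrM (_ : 2 / s * (s / 2) = 1) ?powRr1//.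
  by field; rewrite gt_eqF.
pose z (j : nat) : R := 2^-1 ^+ j.
pose tau j := z j / 4.
pose b j := r0 / 4 * (1 + z j).
pose rho j := kap * gam ^+ j.
have z0 j : 0 < z j by rewrite exprn_gt0.
have z1 j : z j <= 1 by rewrite exprn_ile1// invf_le1// ler1n.
have zS j : z j.+1 = z j / 2 by rewrite /z exprSr.
have tau0 j : 0 < tau j by rewrite divr_gt0.
have tau1 j : tau j <= 1 by rewrite /tau; have := z1 j; lra.
have rho0 j : 0 < rho j by rewrite mulr_gt0// exprn_gt0.
have y0 : 0 < tau 0%N `^ P * rho 0%N ^+ n by rewrite mulr_gt0 ?powR_gt0 ?exprn_gt0.
have [k0 [k00 Yk0]] := excess_small y0.
pose k j := k0 + (1 - z j).
have gamz j : gam ^+ j <= z j by rewrite lerXn2r ?nnegrE ?invr_ge0 ?(ltW gam0).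
have rhoz j : rho j <= r0 / 8 * z j.
  by apply: ler_pM; rewrite ?exprn_ge0 ?(ltW kap0) ?(ltW gam0)// exprn_ge0// ltW.
have bS j : b j - b j.+1 = r0 / 8 * z j by rewrite /b zS; field.
have rhoS j : rho j.+1 = rho j * gam by rewrite /rho exprSr mulrA.
have tauS j : tau j.+1 = tau j / 2 by rewrite /tau zS mulrAC.
have main j : (Y (b j) (k j) <= (tau j `^ P * rho j ^+ n)%:E)%E.
  elim: j => [|j ih].
    rewrite (_ : b 0%N = r0 / 2); last by rewrite /b /z expr0; field.
    by rewrite (_ : k 0%N = k0)// /k /z expr0 subrr addr0.
  have rz := mulr_gt0 r8 (z0 j).
  have zj := z0 j; have zj1 := z1 j; have r_0 := r00.
  have rz4 : r0 / 4 * z j <= r0 / 4 by rewrite ler_piMr// divr_ge0// ltW.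
  have rz8 : r0 / 8 * z j <= r0 / 8 by rewrite ler_piMr// ltW.
  have := step (b j.+1) (b j) (k j) (tau j) (rho j).
  rewrite bS (_ : k j + tau j + tau j = k j.+1); last by rewrite /k zS /tau; field.
  move=> /(_ _ _ _ _ (tau0 j) (tau1 j) (rho0 j) (rhoz j) _ ih) h.
  apply: le_trans (h _ _ _ _ _) _.
  - by rewrite mulr_ge0 ?addr_ge0 ?divr_ge0// ltW.
  - by rewrite -subr_gt0 bS.
  - by rewrite /b; lra.
  - by rewrite /k; lra.
  - by have := rhoz j; lra.
  rewrite lee_fin tauS rhoS exprMn.
  set t := tau j in h *; set rh := rho j in h *.
  have t0 : 0 < t by exact: tau0.
  have rh0 : 0 < rh by exact: rho0.
  have zt : z j = 4 * t by rewrite /t /tau; field.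
  have rhs : rh `^ (s / 2) = kap `^ (s / 2) * (4 `^ (2 * P) * t `^ (2 * P) * z j `^ N).
    rewrite /rh /rho powRM ?(ltW kap0) ?exprn_ge0 ?(ltW gam0)//; congr (_ * _).
    rewrite -powRM// ?(ltW t0)// -zt -powRD ?(gt_eqF zj) ?implybT//.
    rewrite -powR_mulrn ?(ltW gam0)// /gam -!powRrM.
    rewrite (_ : z j = 2 `^ (- j%:R)); last by rewrite /z exprVn powRN powR_mulrn.
    rewrite -powRrM; congr (_ `^ _).
    by field; rewrite gt_eqF.
  have two : (t / 2) `^ P = t `^ P * 2 `^ (- P).
    by rewrite powRM ?(ltW t0)// -[2^-1]powR_inv1// -powRrM mulN1r.
  rewrite powRD ?(gt_eqF rh0) ?implybT// powR_mulrn ?(ltW rh0)// rhs two.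
  rewrite powRM ?(ltW r8) ?(ltW zj)//.
  have e1 : z j `^ (- N) * z j `^ N = 1 by rewrite powRN mulVf// gt_eqF// powR_gt0.
  have e2 : t `^ (- P) * t `^ (2 * P) = t `^ P.
    by rewrite -powRD ?(gt_eqF t0) ?implybT//; congr (_ `^ _); ring.
  have e3 : 2 `^ (- P) * 2 `^ P = 1 :> R by rewrite powRN mulVf// gt_eqF// powR_gt0.
  apply: (@le_trans _ _ (t `^ P * 2 `^ (- P) * (rh ^+ n * (A * kap `^ (s / 2))))); last first.
    by rewrite ler_wpM2l ?mulr_ge0 ?powR_ge0// ler_wpM2l ?exprn_ge0// ltW.
  pose X := C * (r0 / 8) `^ (- N) * kap `^ (s / 2) * 4 `^ (2 * P) * rh ^+ n.
  rewrite [leRHS](_ : _ = X * t `^ P * (2 `^ (- P) * 2 `^ P)); last by rewrite /X /A; ring.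
  rewrite [leLHS](_ : _ = X * (t `^ (- P) * t `^ (2 * P)) * (z j `^ (- N) * z j `^ N)).
    by rewrite e1 e2 e3.
  rewrite /X -/N; ring.
have Y0 : (Y (r0 / 4)%R (k0 + 1)%R <= 0)%E.
  apply/lee_addgt0Pr => e e0; rewrite add0e.
  have [j je] : exists j, z j <= e.
    have [j _ jP] : \forall j \near \oo, `|0 - z j| < e.
      by move: e e0; apply/cvgrPdist_lt; apply: cvg_expr; rewrite ger0_norm// invf_lt1// ltr1n.
    exists j; have := jP j (leqnn _); rewrite sub0r normrN ger0_norm ?(ltW (z0 j))//; exact: ltW.
  apply: (@le_trans _ _ (Y (b j) (k j))).
    apply: (excess_le L).
      by rewrite /b ler_peMr ?divr_ge0 ?(ltW r00)// lerDl ltW.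
    by rewrite /k lerD2l gerBl ltW.
  apply: (le_trans (main j)); rewrite lee_fin; apply: le_trans je.
  apply: (@le_trans _ _ (rho j ^+ n)).
    rewrite ler_piMl ?exprn_ge0 ?(ltW (rho0 j))//.
    rewrite [leRHS](_ : 1 = 1 `^ P); last by rewrite powR1.
    by apply: ler_powR_base; rewrite ?tau1 ?(ltW (tau0 j)) ?(ltW P0).
  have rz : rho j <= z j.
    apply: (le_trans (rhoz j)); rewrite ler_piMl ?(ltW (z0 j))//.
    have : 2 * r0 <= 1.
      apply: le_trans (loc_small L); rewrite ler_wpM2r ?(ltW r00)//.
      by rewrite ler_peMr// ler1n (adm_n H).
    have := r00; lra.
  have rj1 : rho j <= 1 by exact: le_trans (z1 j).
  apply: le_trans rz; rewrite -(prednK (adm_n H)) exprS ler_piMr ?(ltW (rho0 j))//.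
  by rewrite exprn_ile1// ltW.
(* One more unit above the limit level, so that Chebyshev's inequality applies. *)
exists (k0 + 1 + 1); apply/eqP; rewrite eq_le measure_ge0 andbT.
have := le_trans (excess_chebyshev L (r0 / 4) (k0 + 1) ltr01) Y0.
by rewrite powR1 mul1e.
Qed.

End iteration.

(** * Borel representatives *)

Section representative.
Context (R : realType) (n : nat).
Local Notation Rn := 'rV[R]_n.
Local Notation mu := (@lebesgue_rV R n).

(** Countably many sets {u > q}, q rational, determine u; it suffices to discard
    the union of the null sets by which they differ from Borel sets. *)
Lemma borel_representative (u : Rn -> R) : lebesgue_measurable_fun setT u ->
  exists v (N : set Rn), [/\ measurable_fun setT v, measurable N, mu N = 0%E &
    forall x, ~ N x -> u x = v x].
Proof.
move=> mu_.
pose r (k : nat) : R := ratr (odflt 0 (unpickle k)).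
have /choice[AN hAN] k : exists AN : set Rn * set Rn, [/\ measurable AN.1, measurable AN.2,
    mu AN.2 = 0%E & forall x, ~ AN.2 x -> (r k < u x) = `[< AN.1 x >]].
  have [A mA [Z [N [mN N0 ZN]] AZ]] := mu_ `]r k, +oo[%classic (measurable_itv _).
  rewrite setTI in AZ.
  exists (A, N); split => //= x Nx; apply/idP/asboolP => [ru|Ax].
    have : (A `|` Z) x by rewrite AZ /= in_itv/= ru.
    by case=> // /ZN.
  have : (A `|` Z) x by left.
  by rewrite AZ /= in_itv/= andbT.
pose N := \bigcup_k (AN k).2.
have mN : measurable N by apply: bigcup_measurable => k _; case: (hAN k).
have N0 : mu N = 0%E.
  apply/negligibleP => //; apply: negligible_bigcup => k.
  by case: (hAN k) => _ m2 m0 _; exact/negligibleP.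
pose v x := if `[< N x >] then 0 else u x.
exists v, N; split => //; last first.
  by move=> x Nx; rewrite /v; case: asboolP.
move=> _; apply: (measurability _ (RGenOInfty.measurableE R)) => //.
move=> _ [_ [c ->] <-]; rewrite setTI.
rewrite (_ : _ @^-1` _ = ((\bigcup_k (if c < r k then (AN k).1 else set0)) `\` N) `|`
   (if c < 0 then N else set0)); last first.
  apply/seteqP; split => x /=; rewrite in_itv/= andbT /v.
    case: asboolP => Nx; first by move=> ->; right.
    move=> cu; left; split => //.
    have [q] := rat_in_itvoo cu; rewrite in_itv/= => /andP[cq qu].
    have rq : r (pickle q) = ratr q by rewrite /r pickleK.
    exists (pickle q) => //; rewrite rq cq.
    have [_ _ _ h] := hAN (pickle q).
    by apply/asboolP; rewrite -h ?rq// => h2; apply: Nx; exists (pickle q).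
  case=> [[[k _] +] Nx|].
    case: ifP => // ck Ax; case: asboolP => // _.
    have [_ _ _ h] := hAN k.
    have : r k < u x by rewrite h; [exact/asboolP|move=> h2; apply: Nx; exists k].
    exact: lt_trans.
  by case: ifP => // c0 Nx; case: asboolP.
apply: measurableU; last by case: ifP => _; [exact: mN|exact: measurable0].
apply: measurableD => //; apply: bigcup_measurable => k _.
by case: ifP => _; [case: (hAN k)|exact: measurable0].
Qed.

Lemma borel_lebesgue_measurable (u : Rn -> R) : measurable_fun setT u ->
  lebesgue_measurable_fun setT u.
Proof.
move=> mu_ B mB; exists (u @^-1` B); first by rewrite -[X in measurable X]setTI; exact: mu_.
exists set0; first exact: negligible_set0.
by rewrite setU0 setTI.
Qed.

Context (s : R) (p : Rn -> Rn -> R) (u v : Rn -> R) (N : set Rn).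
Hypotheses (mN : measurable N) (N0 : mu N = 0%E) (uv : forall x, ~ N x -> u x = v x).

Lemma modular_congr : modular s p u = modular s p v.
Proof.
apply: (integral_null_congr mN N0) => x Nx; apply: (integral_null_congr mN N0) => y Ny.
by rewrite !uv.
Qed.

Lemma weak_form_congr phi : weak_form s p u phi = weak_form s p v phi.
Proof.
apply: (integral_null_congr mN N0) => x Nx; apply: (integral_null_congr mN N0) => y Ny.
by rewrite !uv.
Qed.

Lemma integral_comp_congr (F : R -> Rn -> \bar R) :
  (\int[mu]_x F (u x) x = \int[mu]_x F (v x) x)%E.
Proof. by apply: (integral_null_congr mN N0) => x Nx; rewrite uv. Qed.

End representative.

Section finiteness.
(* The exponent is bounded, so a function that is in the energy space after
   division by some la is in it with la = 1. *)
Context (R : realType) (n : nat) (s : R) (p : 'rV[R]_n -> 'rV[R]_n -> R) (P : R).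
Hypothesis H : admissible s p P.
Local Notation Rn := 'rV[R]_n.
Local Notation mu := (@lebesgue_rV R n).

Let powR_scale (la t pp : R) : 0 < la -> 0 <= pp -> pp <= P ->
  `|t| `^ pp <= Num.max 1 la `^ P * `|t / la| `^ pp.
Proof.
move=> la0 pp0 ppP.
have m1 : 1 <= Num.max 1 la by rewrite le_max lexx.
apply: (@le_trans _ _ (Num.max 1 la `^ pp * `|t / la| `^ pp)).
  rewrite -powRM//; last exact: le_trans m1.
  apply: ler_powR_base => //; rewrite normrM normfV (gtr0_norm la0) mulrCA ler_peMr//.
  by rewrite ler_pdivlMr// mul1r le_max lexx orbT.
by rewrite ler_wpM2r ?powR_ge0//; exact: ler_powR.
Qed.

Let p0 x y : 0 <= p x y.
Proof. by apply: ltW; exact: lt_trans ltr01 (adm_gt1 H x y). Qed.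

Lemma modular_scale (v : Rn -> R) (la : R) : measurable_fun setT v -> 0 < la ->
  (modular s p (fun x => v x / la)%R < +oo)%E -> (modular s p v < +oo)%E.
Proof.
move=> mv la0; have mv' : measurable_fun setT (fun x => v x / la).
  exact: measurable_funM.
rewrite (modularE H mv) (modularE H mv') => fin.
apply: (@le_lt_trans _ _ ((Num.max 1 la `^ P)%:E * (\int[mu \x mu]_z
   (`|v z.1 / la - v z.2 / la| `^ p z.1 z.2 / kernel_denom s p z.1 z.2)%:E))%E); last first.
  by apply: lte_mul_pinfty => //; rewrite lee_fin powR_ge0.
rewrite -ge0_integralZl_EFin//; last 3 first.
- by move=> z _; rewrite lee_fin divr_ge0 ?powR_ge0 ?kernel_denom_ge0.
- by apply/measurable_EFinP; exact: (measurable_energy H mv').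
- exact: powR_ge0.
apply: ge0_le_integral_total => z; first by rewrite lee_fin divr_ge0 ?powR_ge0 ?kernel_denom_ge0.
rewrite -EFinM lee_fin mulrA ler_wpM2r ?invr_ge0 ?kernel_denom_ge0//.
by rewrite -mulrBl; apply: powR_scale => //; exact: (adm_le H).
Qed.

Lemma integral_scale (v : Rn -> R) (la : R) : measurable_fun setT v -> 0 < la ->
  (\int[mu]_x (`|v x / la| `^ p x x)%:E < +oo)%E ->
  (\int[mu]_x (`|v x| `^ p x x)%:E < +oo)%E.
Proof.
move=> mv la0 fin.
have mpd : measurable_fun setT (fun x => p x x).
  apply: (measurableT_comp (adm_meas H) (_ : measurable_fun setT (fun x : Rn => (x, x)))).
  exact: measurable_fun_pair.
apply: (@le_lt_trans _ _ ((Num.max 1 la `^ P)%:E * (\int[mu]_x (`|v x / la| `^ p x x)%:E))%E); last first.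
  by apply: lte_mul_pinfty => //; rewrite lee_fin powR_ge0.
rewrite -ge0_integralZl_EFin ?powR_ge0//; last first.
  apply/measurable_EFinP; apply: measurable_powR2 => //.
  by apply: measurableT_comp => //; exact: measurable_funM.
apply: ge0_le_integral_total => z; first by rewrite lee_fin powR_ge0.
by rewrite -EFinM lee_fin; apply: powR_scale => //; exact: (adm_le H).
Qed.

End finiteness.

(** * Local bounds for sub- and supersolutions *)

Section pointwise_bound.
Context (R : realType) (n : nat) (s : R) (p : 'rV[R]_n -> 'rV[R]_n -> R) (P : R).
Hypothesis H : admissible s p P.
Local Notation Rn := 'rV[R]_n.
Local Notation mu := (@lebesgue_rV R n).
Hypothesis pc : continuous (fun z : Rn * Rn => p z.1 z.2).

Lemma small_oscillation (x0 : Rn) (dl : R) : 0 < dl ->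
  exists r, 0 < r /\ forall x y, `|x - x0| < r -> `|y - x0| < r ->
    p x0 x0 - dl <= p x y <= p x0 x0 + dl.
Proof.
move=> d0.
have := @pc (x0, x0); move/cvgrPdist_lt => /(_ _ d0) [[A B] [/= nA nB] AB].
have [rA rA0 hA] := (nbhs_ballP _ _).1 nA.
have [rB rB0 hB] := (nbhs_ballP _ _).1 nB.
exists (Num.min rA rB); split; first by rewrite lt_min rA0.
move=> x y; rewrite !lt_min => /andP[xA _] /andP[_ yB].
have h : `|p x0 x0 - p x y| < dl.
  apply: (AB (x, y)); split => /=.
    by apply: hA; rewrite -ball_normE/= distrC.
  by apply: hB; rewrite -ball_normE/= distrC.
move: (ltW h); rewrite distrC ler_norml => /andP[h1 h2].
by apply/andP; split; lra.
Qed.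

(** With sg = s / n, an oscillation 2 dl <= sg^2 / 8 of p leaves room for a power
    q = q1 + sg / 2 below the threshold q1 + sg of [higher_integrability] and for
    the condition n (q2 - q1) <= (s / 2) (q - q2) of [level_mass_le].  The bound
    dl <= p (x0, x0) - 1 keeps q1 >= 1. *)
Lemma subsolution_bounded_near (u : Rn -> R) (Omega : set Rn) (x0 : Rn) (T : R) :
  measurable_fun setT u -> open Omega -> Omega x0 ->
  (\int[mu]_x (`|u x| `^ p x x)%:E < +oo)%E -> (modular s p u < +oo)%E ->
  0 <= T ->
  (forall x, Omega x ->
    (\int[mu]_y (Num.max 0 (u y) `^ (p x y - 1) / (1 + enorm y `^ (n%:R + s * p x y)))%:E <= T%:E)%E) ->
  (forall phi : Rn -> R, measurable_fun setT phi -> (forall x, 0 <= phi x) ->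
    (forall x, ~ Omega x -> phi x = 0) ->
    (\int[mu]_x (`|phi x| `^ p x x)%:E < +oo)%E -> (modular s p phi < +oo)%E ->
    (weak_form s p u phi <= 0)%E) ->
  exists r B, 0 < r /\ mu [set x | ((`|x - x0| < r) && (B < u x))%R] = 0%E.
Proof.
move=> mu_ oO Ox0 iu mu_fin T0 hT sub.
have n0 := adm_n H; have s0 := adm_s0 H; have s1 := adm_s1 H.
have nR : 0 < n%:R :> R by rewrite ltr0n.
have nR1 : 1 <= n%:R :> R by rewrite ler1n.
pose sg := s / n%:R.
have sg0 : 0 < sg by rewrite divr_gt0.
have sg1 : sg <= 1 by rewrite ler_pdivrMr// mul1r; lra.
have nsg : n%:R * sg = s by rewrite /sg mulrC divfK// gt_eqF.
have pgt := adm_gt1 H x0 x0.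
pose dl := Num.min (sg ^+ 2 / 16) (p x0 x0 - 1).
have dl0 : 0 < dl by rewrite lt_min subr_gt0 pgt andbT divr_gt0// exprn_gt0.
have dl1 : dl <= sg ^+ 2 / 16 by rewrite ge_min lexx.
have dl2 : dl <= p x0 x0 - 1 by rewrite ge_min lexx orbT.
have [r1 [r10 osc]] := small_oscillation x0 dl0.
have [r2 r20 hO] := (nbhs_ballP _ _).1 (open_nbhs_nbhs (conj oO Ox0)).
pose r0 := Num.min (Num.min r1 r2) (2 * n%:R)^-1.
have r00 : 0 < r0 by rewrite !lt_min r10 r20 invr_gt0 mulr_gt0.
have r01 : r0 <= r1 by rewrite !ge_min lexx.
have r02 : r0 <= r2 by rewrite !ge_min lexx orbT.
have r03 : 2 * n%:R * r0 <= 1.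
  by rewrite -ler_pdivlMl ?mulr_gt0// mulr1 ge_min lexx orbT.
have cube x : `|x - x0| < r0 -> Omega x.
  move=> xr; apply: hO; rewrite -ball_normE/= distrC; exact: lt_le_trans r02.
pose q1 := p x0 x0 - dl; pose q2 := p x0 x0 + dl; pose q := q1 + sg / 2.
have L : local_data s p u x0 r0 q1 q2.
  split => //; first by rewrite /q1; lra.
  by move=> x y xr yr; apply: osc; [exact: lt_le_trans r01|exact: lt_le_trans r01].
have sg2 : sg ^+ 2 <= sg by rewrite expr2 ler_piMr// ltW.
have q0 : 0 <= q by rewrite /q /q1; lra.
have qq : q < q1 + s / n%:R by rewrite /q -/sg; lra.
have q2q : q2 < q by rewrite /q2 /q /q1; lra.
have gap : n%:R * (q2 - q1) <= s / 2 * (q - q2).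
  rewrite -nsg -2!mulrA ler_wpM2l// /q /q2 /q1.
  have -> : p x0 x0 + dl - (p x0 x0 - dl) = 2 * dl by ring.
  have -> : p x0 x0 - dl + sg / 2 - (p x0 x0 + dl) = sg / 2 - 2 * dl by ring.
  have : sg * dl <= dl by rewrite ler_piMl// ltW.
  rewrite expr2 in dl1; rewrite expr2 in sg2; lra.
have [M [M0 uM]] := higher_integrability H L q0 qq.
have uT x : `|x - x0| < r0 -> (\int[mu]_y (Num.max 0 (u y) `^ (p x y - 1) /
    (1 + enorm y `^ (n%:R + s * p x y)))%:E <= T%:E)%E by move/cube; exact: hT.
have W : local_subsolution s p u x0 r0.
  move=> phi mphi phi0 phiO; apply: sub => // x nOx; apply: phiO.
  by rewrite leNgt; apply/negP => /cube.
have [B hB] := local_upper_bound H L T0 uT W M0 uM q2q gap.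
by exists (r0 / 4), B; split; first exact: divr_gt0.
Qed.

End pointwise_bound.

Section assembly.
Context (R : realType) (n : nat) (s : R) (p : 'rV[R]_n -> 'rV[R]_n -> R) (P : R).
Hypothesis H : admissible s p P.
Local Notation Rn := 'rV[R]_n.
Local Notation mu := (@lebesgue_rV R n).
Hypothesis pc : continuous (fun z : Rn * Rn => p z.1 z.2).

Lemma weak_form_congr_test (N : set Rn) (u phi psi : Rn -> R) :
  measurable N -> mu N = 0%E -> (forall x, ~ N x -> phi x = psi x) ->
  weak_form s p u phi = weak_form s p u psi.
Proof.
move=> mN N0 uv; apply: (integral_null_congr mN N0) => x Nx.
by apply: (integral_null_congr mN N0) => y Ny; rewrite !uv.
Qed.

Lemma Wsp_representative (u : Rn -> R) : Wsp s p u ->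
  exists v (N : set Rn), [/\ measurable_fun setT v, measurable N, mu N = 0%E,
    forall x, ~ N x -> u x = v x &
    (\int[mu]_x (`|v x| `^ p x x)%:E < +oo)%E /\ (modular s p v < +oo)%E].
Proof.
move=> [mu_ [la la0 [iu modu]]].
have [v [N [mv mN N0 uv]]] := borel_representative mu_.
exists v, N; split; [exact: mv|exact: mN|exact: N0|exact: uv|split].
  apply: (integral_scale H mv la0).
  rewrite -(integral_comp_congr mN N0 uv (fun t x => (`|t / la| `^ p x x)%:E)).
  exact: iu.
apply: (modular_scale H mv la0).
rewrite -(@modular_congr _ _ s p (fun x => u x / la) _ N mN N0); first exact: modu.
by move=> x Nx; rewrite uv.
Qed.

Lemma Wsp_borel (v : Rn -> R) : measurable_fun setT v ->
  (\int[mu]_x (`|v x| `^ p x x)%:E < +oo)%E -> (modular s p v < +oo)%E -> Wsp s p v.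
Proof.
move=> mv iv modv; split; first exact: borel_lebesgue_measurable.
exists 1; first exact: ltr01.
split; first by under eq_integral do rewrite divr1; exact: iv.
have -> : (fun x => v x / 1) = v by apply/funext => x; rewrite divr1.
exact: modv.
Qed.

Lemma modularN (u : Rn -> R) : modular s p (fun x => - u x) = modular s p u.
Proof.
apply: eq_integral => x _; apply: eq_integral => y _.
by rewrite -opprD normrN.
Qed.

Lemma WspN (u : Rn -> R) : Wsp s p u -> Wsp s p (fun x => - u x).
Proof.
move=> [mu_ [la la0 [iu modu]]]; split.
  move=> B mB; have := mu_ (-%R @^-1` B); apply.
  by rewrite -[X in measurable X]setTI; exact: oppr_measurable.
exists la; first exact: la0.
split; first by under eq_integral do rewrite mulNr normrN; exact: iu.
have -> : (fun x => - u x / la) = (fun x => - (u x / la)) by apply/funext => x; rewrite mulNr.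
rewrite modularN; exact: modu.
Qed.

(** Negation commutes with the iterated integral only because the weak form is
    absolutely convergent, which is known for Borel representatives of both
    functions. *)
Lemma weak_formN (u phi : Rn -> R) : Wsp s p u -> Wsp s p phi ->
  weak_form s p (fun x => - u x) phi = (- weak_form s p u phi)%E.
Proof.
move=> /Wsp_representative[v [N [mv mN N0 uv [_ modv]]]].
move=> /Wsp_representative[psi [M [mpsi mM M0 phipsi [_ modpsi]]]].
rewrite !(weak_form_congr_test _ mM M0 phipsi).
rewrite (weak_form_congr s p mN N0 uv).
rewrite (@weak_form_congr _ _ s p (fun x => - u x) (fun x => - v x) N mN N0); last first.
  by move=> x Nx; rewrite uv.
have mv' : measurable_fun setT (fun x => - v x) by exact: measurableT_comp.
have modv' : (modular s p (fun x => (- v x)%R) < +oo)%E by rewrite modularN.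
rewrite (weak_formE H mv mpsi modv modpsi) (weak_formE H mv' mpsi modv' modpsi).
have I := flux_integrable H mv mpsi modv modpsi.
rewrite -integralN; last by apply: integrable_add_def; [exact: measurableT|exact: I].
apply: eq_integral => z _; rewrite -EFinN; congr (_%:E).
by rewrite /flux -opprD normrN mulrN !mulNr.
Qed.

Lemma weak_supersolutionN (Omega : set Rn) (u : Rn -> R) :
  weak_supersolution s p Omega u -> weak_subsolution s p Omega (fun x => - u x).
Proof.
move=> [Wu sup]; split; first exact: WspN.
move=> phi tphi; have [Wphi _ _] := tphi.
by rewrite weak_formN// oppe_le0; exact: sup.
Qed.

Lemma tailE (v : Rn -> R) x : tail s p (v^\+)%R x =
  (\int[mu]_y (Num.max 0 (v y) `^ (p x y - 1) / (1 + enorm y `^ (n%:R + s * p x y)))%:E)%E.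
Proof. by apply: eq_integral => y _; rewrite /funrpos maxC. Qed.

Lemma tail_ge0 (v : Rn -> R) x : (0 <= tail s p v x)%E.
Proof.
by apply: integral_ge0 => y _; rewrite lee_fin divr_ge0 ?powR_ge0// addr_ge0 ?powR_ge0.
Qed.

Lemma ae_seq (I : eqType) (l : seq I) (Q : I -> Rn -> Prop) :
  (forall i, i \in l -> {ae mu, forall x, Q i x}) ->
  {ae mu, forall x, forall i, i \in l -> Q i x}.
Proof.
elim: l => [|a l ih] h; first by apply: aeW => x i.
have h1 := h a (mem_head _ _).
have h2 := ih (fun i il => h i (mem_behead (s := a :: l) il)).
apply: filterS2 h1 h2 => x xa xl i.
by rewrite in_cons => /orP[/eqP ->//|]; exact: xl.
Qed.

Lemma locally_bounded_of_near (Omega : set Rn) (u : Rn -> R) :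
  (forall x0, Omega x0 -> exists r B, 0 < r /\
     {ae mu, forall x, `|x - x0| < r -> u x <= B}) ->
  locally_bounded_above Omega u.
Proof.
move=> near K cK KO.
have /choice[rB hrB] x0 : exists rB : R * R, Omega x0 ->
    0 < rB.1 /\ {ae mu, forall x, `|x - x0| < rB.1 -> u x <= rB.2}.
  have [Ox|nOx] := pselect (Omega x0); last by exists (0, 0).
  by have [r [B h]] := near _ Ox; exists (r, B).
move: cK; rewrite compact_cover => /(_ _ Omega (fun x0 => ball x0 (rB x0).1)).
case=> [x0 Ox0|x Kx|D DO KD].
- exact: ball_open.
- by exists x; [exact: KO|apply: ballxx; exact: (hrB _ (KO _ Kx)).1].
exists (\big[Num.max/0]_(i <- finmap.enum_fset D) (rB i).2).
have : {ae mu, forall x, forall i, i \in finmap.enum_fset D ->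
    `|x - i| < (rB i).1 -> u x <= (rB i).2}.
  by apply: ae_seq => i iD; apply: (hrB _ _).2; apply/set_mem; exact: DO.
apply: filterS => x hx Kx; have [i iD] := KD _ Kx.
rewrite -ball_normE/= distrC => /(hx _ iD) h; apply: (le_trans h).
exact: (le_bigmax_seq 0 i predT (fun i => (rB i).2) iD).
Qed.

Lemma subsolution_locally_bounded_above (Omega : set Rn) (u : Rn -> R) :
  open Omega -> Wsp s p u ->
  (ereal_sup [set tail s p (u^\+)%R x | x in Omega] < +oo)%E ->
  weak_subsolution s p Omega u -> locally_bounded_above Omega u.
Proof.
move=> oO Wu tailfin [_ sub].
have [v [N [mv mN N0 uv [iv modv]]]] := Wsp_representative Wu.
apply: locally_bounded_of_near => x0 Ox0.
pose S := ereal_sup [set tail s p (u^\+)%R x | x in Omega].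
have tS x : Omega x -> (tail s p (u^\+)%R x <= S)%E.
  by move=> Ox; apply: ereal_sup_ubound; exists x.
have S0 : (0 <= S)%E by apply: le_trans (tS _ Ox0); exact: tail_ge0.
have Sfin : (fine S)%:E = S by rewrite fineK// ge0_fin_numE.
have T0 : 0 <= fine S by rewrite fine_ge0.
have tv x : Omega x -> (\int[mu]_y (Num.max 0 (v y) `^ (p x y - 1) /
    (1 + enorm y `^ (n%:R + s * p x y)))%:E <= (fine S)%:E)%E.
  move=> Ox; rewrite Sfin; apply: le_trans (tS _ Ox); rewrite tailE.
  by rewrite (integral_comp_congr mN N0 uv (fun t y => (Num.max 0 t `^ (p x y - 1) /
    (1 + enorm y `^ (n%:R + s * p x y)))%:E)).
have subv (phi : Rn -> R) : measurable_fun setT phi -> (forall x, 0 <= phi x) ->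
    (forall x, ~ Omega x -> phi x = 0) ->
    (\int[mu]_x (`|phi x| `^ p x x)%:E < +oo)%E -> (modular s p phi < +oo)%E ->
    (weak_form s p v phi <= 0)%E.
  move=> mphi phi0 phiO iphi modphi.
  rewrite -(weak_form_congr s p mN N0 uv); apply: sub; split.
  - exact: Wsp_borel.
  - exact: aeW.
  - exact: aeW.
have [r [B [r0 hB]]] := subsolution_bounded_near H pc mv oO Ox0 iv modv T0 tv subv.
exists r, B; split => //.
have mE : measurable [set x | ((`|x - x0| < r) && (B < v x))%R].
  apply: measurable_bset; apply: measurable_and; first exact: measurable_in_cube.
  exact: measurable_fun_ltr.
exists ([set x | ((`|x - x0| < r) && (B < v x))%R] `|` N); split.
- exact: measurableU.
- by rewrite measureU0.
move=> x /= /not_implyP[xr ux]; have [Nx|Nx] := pselect (N x); first by right.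
by left => /=; rewrite xr -uv// ltNge; apply/negP.
Qed.

End assembly.

Section reduction.
Context (R : realType) (n : nat).
Local Notation Rn := 'rV[R]_n.
Local Notation mu := (@lebesgue_rV R n).

Lemma admissible_of_bounds (s : R) (p : Rn -> Rn -> R) :
  (0 < n)%N -> 0 < s -> s < 1 ->
  continuous (fun z : Rn * Rn => p z.1 z.2) -> (forall x y, p x y = p y x) ->
  (1 < ereal_inf [set (p x y)%:E | x in setT & y in setT])%E ->
  (ereal_sup [set (p x y)%:E | x in setT & y in setT] < +oo)%E ->
  exists P, admissible s p P.
Proof.
move=> n0 s0 s1 pc ps pinf psup.
set S := ereal_sup _ in psup.
have pS x y : ((p x y)%:E <= S)%E by apply: ereal_sup_ubound; exists x => //; exists y.
have Sfin : (fine S)%:E = S.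
  by rewrite fineK// fin_numElt psup andbT (lt_le_trans _ (pS 0 0))// ltNyr.
exists (fine S); split => //.
- exact: measurable_continuous2.
- move=> x y; rewrite -lte_fin; apply: (lt_le_trans pinf).
  by apply: ereal_inf_lbound; exists x => //; exists y.
- by move=> x y; rewrite -lee_fin Sfin.
Qed.

Lemma bounded_above_below (Omega : set Rn) (u : Rn -> R) :
  locally_bounded_above Omega (fun x => - u x) -> locally_bounded_below Omega u.
Proof.
move=> h K cK KO; have [M hM] := h K cK KO; exists (- M).
by apply: filterS hM => x hx Kx; rewrite lerNl hx.
Qed.

Lemma lebesgue_measurable_open (Omega : set Rn) (u : Rn -> R) : open Omega ->
  lebesgue_measurable_fun setT u -> lebesgue_measurable_fun Omega u.
Proof.
move=> oO mu_ B mB; have [A mA [Z negZ AZ]] := mu_ B mB.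
rewrite setTI in AZ.
exists (Omega `&` A); first by apply: measurableI => //; exact: measurable_open_rV.
exists (Omega `&` Z); last by rewrite -setIUr AZ.
by apply: negligibleS negZ; exact: subIsetr.
Qed.

Lemma Linfty_loc_of_bounds (Omega : set Rn) (u : Rn -> R) : open Omega ->
  lebesgue_measurable_fun setT u ->
  locally_bounded_above Omega u -> locally_bounded_below Omega u ->
  Linfty_loc Omega u.
Proof.
move=> oO mu_ above below; split; first exact: lebesgue_measurable_open.
move=> K cK KO; have [A hA] := above K cK KO; have [B hB] := below K cK KO.
rewrite unlock; case: ifP => // _.
apply: (@le_lt_trans _ _ (`|A| + `|B|)%:E); last exact: ltry.
apply/ess_supP; apply: filterS2 hA hB => x xA xB /=.
rewrite lee_fin patchE; case: ifPn => [/set_mem Kx|_]; last first.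
  by rewrite normr0 addr_ge0.
have := xA Kx; have := xB Kx; rewrite ler_norml.
have := ler_norm A; have := ler_norm (- B); rewrite normrN.
have := normr_ge0 A; have := normr_ge0 B => *.
by apply/andP; split; lra.
Qed.

Lemma tail_le (s : R) (p : Rn -> Rn -> R) (P : R) (Omega : set Rn) (v w : Rn -> R) :
  admissible s p P -> (forall y, 0 <= v y <= w y) ->
  (ereal_sup [set tail s p w x | x in Omega] < +oo)%E ->
  (ereal_sup [set tail s p v x | x in Omega] < +oo)%E.
Proof.
move=> H vw; apply: le_lt_trans; apply: ge_ereal_sup => _ [x Ox <-].
apply: (@le_trans _ _ (tail s p w x)); last by apply: ereal_sup_ubound; exists x.
have d0 y : 0 <= (1 + enorm y `^ (n%:R + s * p x y))^-1.
  by rewrite invr_ge0 addr_ge0// powR_ge0.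
apply: ge0_le_integral_total => y; first by rewrite lee_fin mulr_ge0 ?powR_ge0.
have /andP[v0 vwy] := vw y.
rewrite lee_fin ler_wpM2r//; apply: ler_powR_base => //.
by rewrite subr_ge0 ltW// (adm_gt1 H).
Qed.

End reduction.

Theorem theorem1p4 (R : realType) (n : nat) (Omega : set 'rV[R]_n) (s : R)
    (p : 'rV[R]_n -> 'rV[R]_n -> R)
    (n_gt0 : (0 < n)%N)
    (Omega_domain : domain Omega)
    (Omega_bounded : bounded_set Omega)
    (s_gt0 : 0 < s) (s_lt1 : s < 1)
    (p_continuous : continuous (fun z : 'rV[R]_n * 'rV[R]_n => p z.1 z.2))
    (p_sym : forall x y : 'rV[R]_n, p x y = p y x)
    (p_inf : (1 < ereal_inf [set (p x y)%:E | x in setT & y in setT])%E)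
    (p_sup : (ereal_sup [set (p x y)%:E | x in setT & y in setT] < +oo)%E) :
  [/\ (forall u : 'rV[R]_n -> R,
         Wsp s p u ->
         (ereal_sup [set tail s p (u^\+)%R x | x in Omega] < +oo)%E ->
         weak_subsolution s p Omega u ->
         locally_bounded_above Omega u),
      (forall u : 'rV[R]_n -> R,
         Wsp s p u ->
         (ereal_sup [set tail s p (u^\-)%R x | x in Omega] < +oo)%E ->
         weak_supersolution s p Omega u ->
         locally_bounded_below Omega u)
    & (forall u : 'rV[R]_n -> R,
         Wsp s p u ->
         weak_solution s p Omega u ->
         (ereal_sup [set tail s p (fun y => `|u y|)%R x | x in Omega] < +oo)%E ->
         Linfty_loc Omega u)].
Proof.
have [P H] := admissible_of_bounds n_gt0 s_gt0 s_lt1 p_continuous p_sym p_inf p_sup.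
have [oO _ _] := Omega_domain.
have sub u : Wsp s p u -> (ereal_sup [set tail s p (u^\+)%R x | x in Omega] < +oo)%E ->
    weak_subsolution s p Omega u -> locally_bounded_above Omega u.
  exact: (subsolution_locally_bounded_above H p_continuous oO).
have super u : Wsp s p u -> (ereal_sup [set tail s p (u^\-)%R x | x in Omega] < +oo)%E ->
    weak_supersolution s p Omega u -> locally_bounded_below Omega u.
  move=> Wu tu su; apply: bounded_above_below; apply: sub.
  - exact: WspN.
  - by have -> : ((fun x => - u x)^\+ = u^\-)%R.
  - exact: (weak_supersolutionN H).
split => // u Wu [subu superu] tu.
apply: (Linfty_loc_of_bounds oO (proj1 Wu)).
- apply: (sub u Wu _ subu); apply: (tail_le H _ tu) => y.
  by rewrite /funrpos le_max lexx orbT ge_max ler_norm normr_ge0.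
- apply: (super u Wu _ superu); apply: (tail_le H _ tu) => y.
  by rewrite /funrneg le_max lexx orbT ge_max normr_ge0 andbT -normrN ler_norm.
Qed.
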